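(* The following decision problem is in $\mathsf{P}$ (solvable in time polynomial in $n$): given a Dyck path $d$ of length $n$ and a weight $\alpha\in\mathbb{N}^n$, decide whether the coefficient $c^d_\alpha$ of $\mathbf{x}^\alpha$ in $X_{G(d)}$ is nonzero.
   Context: A Dyck path $d$ of length $n$ is a lattice path from $(0,0)$ to $(n,n)$ with steps $\mathsf{n}=(0,1)$ and $\mathsf{e}=(1,0)$ not going below $y=x$; it is input as a string of length $2n$ in the letters $\mathsf{n},\mathsf{e}$. Its Hessenberg function is: $h_d(i)$ is the number of $\mathsf n$ steps preceding the $i$-th $\mathsf e$ step. The indifference graph $G(d)$ has vertex set $[n]$ with an edge between $i<j$ iff $j\le h_d(i)$. For a graph $G$, $X_G=\sum_f\prod_{v\in V(G)}x_{f(v)}$, summed over all proper colorings $f:V(G)\to\{1,2,\ldots\}$ (adjacent vertices get different colors). Write $X_{G(d)}=\sum_\alpha c^d_\alpha\mathbf{x}^\alpha$, so $c^d_\alpha$ is the number of proper colorings of $G(d)$ with exactly $\alpha_i$ vertices of color $i$ for each $i$. *)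

(* Defs.v *)
From HB Require Import structures.
From Corelib Require Import PosDef.
From mathcomp Require Import all_boot finmap.
From mathcomp Require Import boolp classical_sets functions cardinality.

Set Implicit Arguments.
Unset Strict Implicit.
Unset Printing Implicit Defensive.

(** * Deterministic multi-tape Turing machines and the class P *)

Inductive direction := MoveLeft | Stay | MoveRight.

(* A two-way infinite tape: the cells left of the head (nearest first), the
   scanned cell, the cells right of the head (nearest first). All the cells
   that are not listed are blank. *)
Record tape (G : Type) :=
  Tape { tape_left : seq G; tape_head : G; tape_right : seq G }.

(* Tape symbols: [None] is the blank, [Some (inl s)] an input symbol and
   [Some (inr x)] an auxiliary symbol of the machine. *)
Definition tape_symbol (S X : Type) : Type := option (S + X).

(* [tm_verdict q] is [Some true] if [q] is an accepting halting state,
   [Some false] if it is a rejecting one, [None] if it is not halting. *)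
Record tm (S : finType) := TM {
  tm_tapes : nat;
  tm_state : finType;
  tm_aux : finType;
  tm_start : tm_state;
  tm_verdict : tm_state -> option bool;
  tm_delta : tm_state -> {ffun 'I_tm_tapes.+1 -> tape_symbol S tm_aux} ->
    tm_state * {ffun 'I_tm_tapes.+1 -> tape_symbol S tm_aux * direction}
}.

Section Run.
Variables (S : finType) (M : tm S).

Let symbol := tape_symbol S (tm_aux M).

Definition tm_config : Type :=
  tm_state M * {ffun 'I_(tm_tapes M).+1 -> tape symbol}.

Definition tape_of_word (w : seq S) : tape symbol :=
  if w is s :: w' then Tape [::] (Some (inl s)) [seq Some (inl x) | x <- w']
  else Tape [::] None [::].

Definition tm_init (w : seq S) : tm_config :=
  (tm_start M, [ffun i => tape_of_word (if i == ord0 then w else [::])]).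

Definition tape_act (t : tape symbol) (a : symbol * direction) : tape symbol :=
  let: Tape l _ r := t in
  let: (g, dir) := a in
  match dir with
  | MoveLeft => Tape (behead l) (head None l) (g :: r)
  | Stay => Tape l g r
  | MoveRight => Tape (g :: l) (head None r) (behead r)
  end.

Definition tm_step (c : tm_config) : tm_config :=
  let: (q, ts) := c in
  if tm_verdict q is Some _ then c else
  let: (q', acts) := tm_delta q [ffun i => tape_head (ts i)] in
  (q', [ffun i => tape_act (ts i) (acts i)]).

Definition tm_run (t : nat) (w : seq S) : tm_config :=
  iter t tm_step (tm_init w).

(* Halting configurations are fixed by [tm_step], so this says that [M] halts
   on [w] after at most [t] steps, with verdict [b]. *)
Definition tm_halts_within (w : seq S) (t : nat) (b : bool) : Prop :=
  tm_verdict (tm_run t w).1 = Some b.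

End Run.

(* The problem with instances [I] and yes-instances [yes], whose instances are
   given to the machine as the words [code x], is solvable in time polynomial
   in the parameter [param x]. *)
Definition solvable_in_poly_time (S : finType) (I : Type)
    (code : I -> seq S) (param : I -> nat) (yes : I -> Prop) : Prop :=
  exists (M : tm S) (c k : nat), forall x : I, exists b : bool,
    tm_halts_within M (code x) (c * param x ^ k + c) b /\ (b <-> yes x).

Definition in_P (S : finType) (L : seq S -> Prop) : Prop :=
  solvable_in_poly_time (fun w : seq S => w) (fun w : seq S => size w) L.

(** * Dyck paths and indifference graphs *)

Inductive step := north | east.

Definition step_code (s : step) : bool := if s is north then true else false.
Definition step_decode (b : bool) : step := if b then north else east.
Lemma step_codeK : cancel step_code step_decode.
Proof. by case. Qed.
HB.instance Definition _ := Finite.copy step (can_type step_codeK).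

Definition is_dyck (n : nat) (d : seq step) : Prop :=
  [/\ count_mem north d = n, count_mem east d = n &
      forall k, count_mem east (take k d) <= count_mem north (take k d)].

Definition east_positions (d : seq step) : seq nat :=
  [seq j <- iota 0 (size d) | nth north d j == east].

(* [i] ranges over 1, ..., n. *)
Definition hessenberg (d : seq step) (i : nat) : nat :=
  count_mem north (take (nth 0 (east_positions d) i.-1) d).

(* The element [i] of ['I_n] stands for the vertex [i.+1] of {1, ..., n}. *)
Definition indifference_graph (n : nat) (d : seq step) : rel 'I_n :=
  fun i j => ((i < j) && (j.+1 <= hessenberg d i.+1))
          || ((j < i) && (i.+1 <= hessenberg d j.+1)).

(** * Chromatic symmetric functions *)

Section Chromatic.
Variables (T : finType) (e : rel T).

Definition proper_coloring (f : {ffun T -> nat}) : Prop :=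
  forall u v, e u v -> f u <> f v.

(* The exponent of the [i]-th variable in the product of the [x_(f v)]. *)
Definition color_exponent (f : {ffun T -> nat}) (i : nat) : nat :=
  #|[pred v | f v == i]|.

Definition colorings_of_weight (a : nat -> nat) : set {ffun T -> nat} :=
  [set f | proper_coloring f /\ color_exponent f =1 a]%classic.

Lemma finite_colorings_of_weight a : finite_set (colorings_of_weight a).
Proof.
have [[f0 [_ wf0]]|no] := pselect (exists f, colorings_of_weight a f); last first.
  suff -> : colorings_of_weight a = set0 by [].
  by apply/seteqP; split=> f // cf; case: no; exists f.
pose m := (\max_v f0 v).+1.
pose g (h : {ffun T -> 'I_m}) : {ffun T -> nat} := [ffun v => h v : nat].
apply: (@sub_finite_set _ _ (g @` [set: {ffun T -> 'I_m}])%classic); last first.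
  by apply: finite_image; apply: finite_finset.
move=> f [_ wf].
have ltm v : f v < m.
  have : 0 < color_exponent f0 (f v).
    by rewrite wf0 -wf; apply/card_gt0P; exists v; rewrite inE.
  by case/card_gt0P=> u; rewrite inE => /eqP <-; rewrite ltnS leq_bigmax.
exists [ffun v => Ordinal (ltm v)] => //.
by apply/ffunP => v; rewrite !ffunE.
Qed.

(* The chromatic symmetric function, a formal power series in infinitely many
   variables, given as the function that maps an exponent [a] to the
   coefficient of x^a. Colors and variables are indexed from 0. *)
Definition chromatic_series (a : nat -> nat) : nat :=
  #|` fset_set (colorings_of_weight a)|%fset.

End Chromatic.

(** * The decision problem *)

Record instance := Instance {
  inst_n : nat;
  inst_path : seq step;
  inst_dyck : is_dyck inst_n inst_path;
  inst_weight : inst_n.-tuple nat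
}.

Definition nonvanishing (x : instance) : Prop :=
  chromatic_series (indifference_graph (n := inst_n x) (inst_path x))
    (nth 0 (inst_weight x)) <> 0.

(* The input alphabet: steps, binary digits, and a separator. *)
Definition letter : finType := (step + bool + unit)%type.
Definition letter_step (s : step) : letter := inl (inl s).
Definition letter_bit (b : bool) : letter := inl (inr b).
Definition letter_sep : letter := inr tt.

(* Binary digits, most significant first, without leading zeros. *)
Fixpoint bits_of_pos (p : positive) : seq bool :=
  match p with
  | xH => [:: true]
  | xO p' => rcons (bits_of_pos p') false
  | xI p' => rcons (bits_of_pos p') true
  end.

Definition bits_of_nat (m : nat) : seq bool :=
  if bin_of_nat m is BinNums.Npos p then bits_of_pos p else [:: false].

Definition encode_weight (a : nat) : seq letter :=
  letter_sep :: [seq letter_bit b | b <- bits_of_nat a].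

Definition encode (x : instance) : seq letter :=
  [seq letter_step s | s <- inst_path x]
    ++ flatten [seq encode_weight a | a <- inst_weight x].

(* Words that do not encode an instance are not in the language. *)
Definition nonvanishing_language (w : seq letter) : Prop :=
  exists x : instance, w = encode x /\ nonvanishing x.

(* Main.v *)
Require Import Defs.
From mathcomp Require Import all_boot.
From mathcomp Require Import boolp classical_sets cardinality finmap.
From mathcomp Require Import zify.

(* Read the Dyck path from left to right: a north step is a new vertex, an east
   step retires the oldest vertex not yet retired, and two vertices are adjacent
   iff they are present at the same time. Giving each new vertex a color of
   largest remaining capacity among those that no present vertex has finds a
   coloring of the given weight whenever there is one: if a coloring uses c
   where the greedy choice is c', swap c and c' from that vertex on, up to the
   place where c' is about to overtake c; no edge of these colors crosses that
   place. So it is enough to keep the list of the capacities of the free colors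
   and the queue of those of the colors in use, in unary.
     While a weight is read, every bit doubles its current value at the expense
   of what the previous weights leave of n, and the input is rejected as soon as
   this is exhausted. Hence the running time is polynomial in the length of the
   path alone, for arbitrary words, and one machine serves both claims. *)

Set Implicit Arguments.
Unset Strict Implicit.
Unset Printing Implicit Defensive.

(** * Stack machines *)

Section StackMachines.
Variables (G : finType) (k : nat).

(* The [i]-th stack is [nth [::] s i]; its top is its first element. *)
Definition store := seq (seq G).

Inductive stack_op := Nop | Push of 'I_k & G | Pop of 'I_k.

Definition tops (s : store) : {ffun 'I_k -> option G} :=
  [ffun i : 'I_k => ohead (nth [::] s i)].

Definition stack_act (o : stack_op) (s : store) : store :=
  match o with
  | Nop => s
  | Push i a => set_nth [::] s i (a :: nth [::] s i)
  | Pop i => set_nth [::] s i (behead (nth [::] s i))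
  end.

(* [inr None] leaves the machine normally, [inr (Some b)] stops the whole
   computation with verdict [b]. *)
Record stack_machine := StackMachine {
  ctl : finType;
  entry : ctl;
  next : ctl -> {ffun 'I_k -> option G} -> stack_op * (ctl + option bool)
}.

Definition exit_result (s : store) (e : option bool) : store + bool :=
  if e is Some b then inr b else inl s.

Inductive runs (M : stack_machine) :
    ctl M -> store -> nat -> store + bool -> Prop :=
| runs_exit c s o e : next c (tops s) = (o, inr e) ->
    runs c s 1 (exit_result (stack_act o s) e)
| runs_step c s o c' t r : next c (tops s) = (o, inl c') ->
    runs c' (stack_act o s) t r -> runs c s t.+1 r.

Definition exec (M : stack_machine) (s : store) (t : nat) (r : store + bool) :=
  exists2 t', t' <= t & runs (entry M) s t' r.

Lemma exec_weaken M s t t' r : t <= t' -> exec M s t r -> exec M s t' r.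
Proof. by move=> tt' [u ut Hu]; exists u => //; apply: leq_trans tt'. Qed.

Definition top_op (f : {ffun 'I_k -> option G} -> stack_op) : stack_machine :=
  @StackMachine unit tt (fun _ h => (f h, inr None)).

Definition op (o : stack_op) : stack_machine := top_op (fun=> o).

Definition stop (b : bool) : stack_machine :=
  @StackMachine unit tt (fun _ _ => (Nop, inr (Some b))).

Definition seqm (M N : stack_machine) : stack_machine :=
  @StackMachine (ctl M + ctl N)%type (inl (entry M)) (fun c h =>
    match c with
    | inl c => let: (o, x) := next c h in
               (o, match x with
                   | inl c' => inl (inl c')
                   | inr None => inl (inr (entry N))
                   | inr (Some b) => inr (Some b)
                   end)
    | inr c => let: (o, x) := next c h in
               (o, match x with inl c' => inl (inr c') | inr e => inr e end)
    end).

Definition ifm (p : pred {ffun 'I_k -> option G}) (M N : stack_machine) :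
    stack_machine :=
  @StackMachine (option (ctl M + ctl N))%type None (fun c h =>
    match c with
    | None => (Nop, inl (Some (if p h then inl (entry M) else inr (entry N))))
    | Some (inl c) =>
        let: (o, x) := next c h in
        (o, match x with inl c' => inl (Some (inl c')) | inr e => inr e end)
    | Some (inr c) =>
        let: (o, x) := next c h in
        (o, match x with inl c' => inl (Some (inr c')) | inr e => inr e end)
    end).

Definition whilem (p : pred {ffun 'I_k -> option G}) (M : stack_machine) :
    stack_machine :=
  @StackMachine (option (ctl M)) None (fun c h =>
    match c with
    | None => (Nop, if p h then inl (Some (entry M)) else inr None)
    | Some c => let: (o, x) := next c h in
                (o, match x with
                    | inl c' => inl (Some c')
                    | inr None => inl None
                    | inr (Some b) => inr (Some b)
                    end)
    end).

Lemma exec_top_op f s : exec (top_op f) s 1 (inl (stack_act (f (tops s)) s)).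
Proof. by exists 1 => //; apply: (@runs_exit (top_op f) tt s _ None). Qed.

Lemma exec_op o s : exec (op o) s 1 (inl (stack_act o s)).
Proof. exact: exec_top_op. Qed.

Lemma exec_stop b s : exec (stop b) s 1 (inr b).
Proof. by exists 1 => //; apply: (@runs_exit (stop b) tt s Nop (Some b)). Qed.

Lemma exec_seqm_stop M N s t b :
  exec M s t (inr b) -> exec (seqm M N) s t (inr b).
Proof.
case=> u ut Hu; exists u => // {t ut}.
move Er: (inr b) Hu => r Hu; rewrite /=.
elim: Hu Er => {s u r} [c s o [b'|] Ec //= [?]|c s o c' t r Ec _ IH /IH {}IH].
  by subst b'; apply: (@runs_exit (seqm M N) (inl c) _ o (Some b)); rewrite /= Ec.
by apply: (@runs_step (seqm M N)) IH; rewrite /= Ec.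
Qed.

(** The exit step of [M] becomes the jump to the entry of [N], so sequencing costs no extra step;
    [ifm] and [whilem] pay one step per test. *)
Lemma exec_seqm M N s t s' t' r :
  exec M s t (inl s') -> exec N s' t' r -> exec (seqm M N) s (t + t') r.
Proof.
case=> u ut Hu [u' ut' Hu']; exists (u + u'); first exact: leq_add.
have {}Hu' : @runs (seqm M N) (inr (entry N)) s' u' r.
  elim: Hu' => {Hu ut' s' u' r} [c s1 o e Ec|c s1 o c' t1 r Ec _ IH].
    by apply: (@runs_exit (seqm M N)); rewrite /= Ec.
  by apply: (@runs_step (seqm M N)) IH; rewrite /= Ec.
move Er1: (inl s') Hu => r1 Hu; rewrite /=.
elim: Hu Er1 => {ut s u r1} [c s o [b'|] Ec //= [?]|c s o c' t1 r1 Ec _ IH /IH {}IH].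
  by subst s'; apply: (@runs_step (seqm M N)) Hu'; rewrite /= Ec.
by rewrite addSn; apply: (@runs_step (seqm M N)) IH; rewrite /= Ec.
Qed.

Lemma exec_ifm_true (p : pred {ffun 'I_k -> option G}) M N s t r :
  p (tops s) -> exec M s t r -> exec (ifm p M N) s t.+1 r.
Proof.
move=> ps [u ut Hu]; exists u.+1 => //.
apply: (@runs_step (ifm p M N) None s Nop (Some (inl (entry M)))) => /=.
  by rewrite ps.
elim: Hu => {ut ps t s u r} [c s1 o e Ec|c s1 o c' t1 r Ec _ IH].
  by apply: (@runs_exit (ifm p M N)); rewrite /= Ec.
by apply: (@runs_step (ifm p M N)) IH; rewrite /= Ec.
Qed.

Lemma exec_ifm_false (p : pred {ffun 'I_k -> option G}) M N s t r :
  ~~ p (tops s) -> exec N s t r -> exec (ifm p M N) s t.+1 r.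
Proof.
move=> ps [u ut Hu]; exists u.+1 => //.
apply: (@runs_step (ifm p M N) None s Nop (Some (inr (entry N)))) => /=.
  by rewrite (negbTE ps).
elim: Hu => {ut ps t s u r} [c s1 o e Ec|c s1 o c' t1 r Ec _ IH].
  by apply: (@runs_exit (ifm p M N)); rewrite /= Ec.
by apply: (@runs_step (ifm p M N)) IH; rewrite /= Ec.
Qed.

Lemma exec_whilem_done (p : pred {ffun 'I_k -> option G}) M s :
  ~~ p (tops s) -> exec (whilem p M) s 1 (inl s).
Proof.
move=> ps; exists 1 => //.
by apply: (@runs_exit (whilem p M) None s Nop None); rewrite /= (negbTE ps).
Qed.

Lemma exec_whilem_stop (p : pred {ffun 'I_k -> option G}) M s t b :
  p (tops s) -> exec M s t (inr b) -> exec (whilem p M) s t.+1 (inr b).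
Proof.
move=> ps [u ut Hu]; exists u.+1 => // {t ut}.
apply: (@runs_step (whilem p M) None s Nop (Some (entry M))) => /=.
  by rewrite ps.
move Er: (inr b) Hu => r Hu.
elim: Hu Er => {ps s u r} [c s o [b'|] Ec //= [?]|c s o c' t r Ec _ IH /IH {}IH].
  by subst b'; apply: (@runs_exit (whilem p M) (Some c) _ o (Some b)); rewrite /= Ec.
by apply: (@runs_step (whilem p M)) IH; rewrite /= Ec.
Qed.

Lemma exec_whilem (p : pred {ffun 'I_k -> option G}) M s t s' t' r :
  p (tops s) -> exec M s t (inl s') -> exec (whilem p M) s' t' r ->
  exec (whilem p M) s (t + t').+1 r.
Proof.
move=> ps [u ut Hu] [u' ut' Hu'].
exists (u + u').+1; first by rewrite ltnS leq_add.
apply: (@runs_step (whilem p M) None s Nop (Some (entry M))) => /=.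
  by rewrite ps.
move Er1: (inl s') Hu => r1 Hu.
elim: Hu Er1 => {ps ut s u r1} [c s o [b'|] Ec //= [?]|c s o c' t1 r1 Ec _ IH /IH {}IH].
  by subst s'; apply: (@runs_step (whilem p M)) Hu'; rewrite /= Ec.
by rewrite addSn; apply: (@runs_step (whilem p M)) IH; rewrite /= Ec.
Qed.

End StackMachines.

(** * Stack machines as Turing machines *)

Section Compilation.
Variables (G : finType) (k : nat) (M : stack_machine G k.+1).

Let symbol := tape_symbol G void.

Definition stack_head (g : symbol) : option G :=
  if g is Some (inl a) then Some a else None.

(* A push takes two steps: the head first moves to the left, and the pending
   symbol, kept in the state, is then written. *)
Definition tm_of_stack_state : finType :=
  ((ctl M + option bool) * option ('I_k.+1 * G))%type.

(** A pop moves the head to the right without erasing. The old symbol then lies to the left of the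
    head, and a later push overwrites it before it can count as a top. *)
Definition tm_of_stack_delta (q : tm_of_stack_state)
    (h : {ffun 'I_k.+1 -> symbol}) :
    tm_of_stack_state * {ffun 'I_k.+1 -> symbol * direction} :=
  match q with
  | (c, Some (i, a)) =>
      ((c, None), [ffun j => if j == i then (Some (inl a), Stay) else (h j, Stay)])
  | (inl c, None) =>
      let: (o, x) := next c [ffun i => stack_head (h i)] in
      match o with
      | Nop => ((x, None), [ffun j => (h j, Stay)])
      | Push i a => ((x, Some (i, a)),
          [ffun j => (h j, if j == i then MoveLeft else Stay)])
      | Pop i => ((x, None),
          [ffun j => (h j, if j == i then MoveRight else Stay)])
      end
  | (inr e, None) => ((inr e, None), [ffun j => (h j, Stay)])
  end.

(** A normal exit [inr None] has no verdict and loops forever; only an exit with a verdict halts. *)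
Definition tm_of_stack : tm G :=
  @TM G k tm_of_stack_state void (inl (entry M), None)
    (fun q => if q.1 is inr e then e else None) tm_of_stack_delta.

(* Whatever is to the left of the head is ignored. *)
Definition represents (ts : {ffun 'I_k.+1 -> tape symbol}) (s : store G) :=
  forall (i : 'I_k.+1) j, nth None (tape_head (ts i) :: tape_right (ts i)) j =
    nth None [seq Some (inl x) | x <- nth [::] s i] j.

Lemma represents_tops ts s : represents ts s ->
  [ffun i => stack_head ([ffun i => tape_head (ts i)] i)] = tops k.+1 s.
Proof.
move=> rep; apply/ffunP => i; rewrite !ffunE; have /= -> := rep i 0.
by case: (nth [::] s i).
Qed.

Lemma nth_head_behead (T : Type) (x : T) s j :
  nth x (head x s :: behead s) j = nth x s j.
Proof. by case: s j => [|y s] [|j] //=; rewrite nth_nil. Qed.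

Lemma represents_init w :
  represents (tm_init tm_of_stack w).2 (w :: nseq k [::]).
Proof.
move=> i j; rewrite /= ffunE; case: (i =P ord0) => [->|].
  by case: w j => [|a w] [|j] //=; rewrite !nth_nil.
case: i => [[|i] ?] ne; first by case: ne; apply: val_inj.
by rewrite /= nth_nseq if_same; case: j => [|j] //=; rewrite !nth_nil.
Qed.

Lemma runs_tm_of_stack c s t b ts :
  runs (M := M) c s t (inr b) -> represents ts s ->
  exists2 t', t' <= 2 * t &
    tm_verdict (iter t' (@tm_step G tm_of_stack) ((inl c, None), ts)).1 = Some b.
Proof.
move Er: (inr b) => r Hr; elim: Hr Er ts => {c s t r}.
  move=> c s o [b'|] //= Ec [->] ts rep.
  (* A push still pending at the exit does not delay the verdict, which depends on the first
     component of the state only. *)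
  exists 1 => //=; rewrite /tm_of_stack_delta /= (represents_tops rep) Ec.
  by case: o Ec.
move=> c s o c' t r Ec _ IH /IH {}IH ts rep.
pose step1 := @tm_step G tm_of_stack.
suff [t1 [ts1 [t12 E rep1]]] : exists t1 ts1, [/\ t1 <= 2,
    iter t1 step1 ((inl c, None), ts) = ((inl c', None), ts1) &
    represents ts1 (stack_act o s)].
  have [t2 t2t Ht2] := IH _ rep1.
  exists (t2 + t1); first by lia.
  by rewrite iterD E.
have E1 : step1 ((inl c, None), ts) =
    let: (q', acts) := tm_of_stack_delta (inl c, None) [ffun i => tape_head (ts i)] in
    (q', [ffun i => @tape_act G tm_of_stack (ts i) (acts i)]) by [].
rewrite /tm_of_stack_delta (represents_tops rep) Ec in E1.
case: o {IH} Ec E1 => [|i a|i] Ec E1.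
- exists 1; eexists; split; [by []|exact: E1|].
  by move=> i j /=; rewrite !ffunE -rep; case: (ts i).
- exists 2; eexists; split; [by []| |].
    by rewrite -[iter 2 _ _]/(step1 (step1 _)) E1; reflexivity.
  move=> i' j; rewrite /= !ffunE nth_set_nth /= -val_eqE /=.
  have := rep i'; case: eqVneq => [/val_inj ->|ne] R.
    by case: (ts i) R => l g r0 /= R; case: j => [|j] //=; rewrite R.
  by case: (ts i') R => l g r0 /= R; rewrite R.
- exists 1; eexists; split; [by []|exact: E1|].
  move=> i' j; rewrite /= !ffunE nth_set_nth /= -val_eqE /=.
  have := rep i'; case: eqVneq => [/val_inj ->|ne] R.
    case: (ts i) R => l g r0 /= R; rewrite nth_head_behead.
    rewrite -[LHS]/(nth None (g :: r0) j.+1) R.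
    by case: (nth [::] s i) => //=; rewrite !nth_nil.
  by case: (ts i') R => l g r0 /= R; rewrite R.
Qed.

Lemma exec_tm_of_stack w t b :
  exec M (w :: nseq k [::]) t (inr b) -> tm_halts_within tm_of_stack w (2 * t) b.
Proof.
case=> u ut Hu.
have [t' t't Ht'] := runs_tm_of_stack Hu (represents_init w).
rewrite /tm_halts_within /tm_run.
have -> : 2 * t = (2 * t - t') + t' by lia.
rewrite iterD; move: (iter t' _ _) Ht' => -[q ts] Ht'.
suff -> n : iter n (@tm_step G tm_of_stack) (q, ts) = (q, ts) by [].
elim: n => // n; rewrite iterS => ->.
by rewrite /tm_step -[tm_verdict q]/(tm_verdict (q, ts).1) Ht'.
Qed.

End Compilation.

(** * The greedy coloring *)

(** A single pass that carries the largest value seen and leaves the smaller one behind, which two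
    stacks can do block by block. Started from 0, it puts a spurious 0 into the list; this is never
    chosen, since a chosen capacity must be positive. *)
Fixpoint extract_max (x : nat) (M : seq nat) : seq nat * nat :=
  if M is m :: M' then
    let: (L, y) := extract_max (maxn x m) M' in (minn x m :: L, y)
  else ([::], x).

Lemma perm_extract_max x M :
  perm_eq ((extract_max x M).2 :: (extract_max x M).1) (x :: M).
Proof.
elim: M x => //= m M IH x; apply/permP => p.
have /permP/(_ p) := IH (maxn x m); case: extract_max => L y /=.
by case: (leqP x m) => _; lia.
Qed.

Lemma extract_max_ge x M y : y \in x :: M -> y <= (extract_max x M).2.
Proof.
elim: M x y => [|m M IH] x y; first by rewrite inE => /eqP ->.
have := IH (maxn x m); rewrite /=; case: extract_max => L z /= {}IH.
have mz : maxn x m <= z by apply: IH; rewrite inE eqxx.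
rewrite !inE => /or3P[/eqP ->|/eqP ->|yM].
- by apply: leq_trans mz; rewrite leq_maxl.
- by apply: leq_trans mz; rewrite leq_maxr.
by apply: IH; rewrite inE yM orbT.
Qed.

Lemma size_extract_max x M : size (extract_max x M).1 = size M.
Proof. by have /perm_size[] := perm_extract_max x M. Qed.

Lemma sumn_extract_max x M :
  (extract_max x M).2 + sumn (extract_max x M).1 = x + sumn M.
Proof. exact: perm_sumn (perm_extract_max x M). Qed.

(* [M] lists the remaining capacities of the colors that may be used for the
   next vertex, and [Q] those of the colors of the vertices whose east step is
   still to come, in the order of the vertices. *)
Fixpoint greedy (d : seq step) (M Q : seq nat) : bool :=
  match d with
  | [::] => true
  | north :: d' => let: (M', x) := extract_max 0 M in
                   (0 < x) && greedy d' M' (rcons Q x.-1)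
  | east :: d' => greedy d' (head 0 Q :: M) (behead Q)
  end.

(** * The Hessenberg function by recursion on the path *)

Fixpoint hess (d : seq step) (i : nat) : nat :=
  match d, i with
  | [::], _ => 0
  | north :: d', _ => (hess d' i).+1
  | east :: d', 0 => 0
  | east :: d', i'.+1 => hess d' i'
  end.

Lemma east_positions_cons s d : east_positions (s :: d) =
  if s == east then 0 :: map S (east_positions d) else map S (east_positions d).
Proof.
rewrite /east_positions /= (iotaDl 1 0) filter_map /=.
by case: (s == east).
Qed.

Lemma size_east_positions d : size (east_positions d) = count_mem east d.
Proof.
elim: d => //= s d IH; rewrite east_positions_cons fun_if /= size_map IH.
by case: (s == east).
Qed.

Lemma hessenbergE d i : i < count_mem east d -> hessenberg d i.+1 = hess d i.
Proof.
rewrite /hessenberg /= -size_east_positions.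
elim: d i => [|s d IH] i //; rewrite east_positions_cons.
case: s => /=.
  by rewrite size_map => id; rewrite (nth_map 0) //= add1n IH.
by case: i => [|i] //=; rewrite ltnS size_map => id; rewrite (nth_map 0) //= IH.
Qed.

(** Past the last east step [hess] stays at the number of north steps, so monotonicity holds on all
    natural numbers. *)
Lemma hess_mono d : {homo hess d : i j / i <= j}.
Proof. by elim: d => // -[] d IH // [|i] [|j] //= ij; rewrite ?ltnS IH. Qed.

Lemma hess_cat_ge d1 d2 i : count_mem east d1 <= i ->
  hess (d1 ++ d2) i = count_mem north d1 + hess d2 (i - count_mem east d1).
Proof.
elim: d1 i => [|[] d1 IH] i //=; first by rewrite subn0.
  by rewrite add0n => di; rewrite IH.
by case: i => // i di; rewrite IH.
Qed.

Lemma hess_cat_lt d1 d2 i : i < count_mem east d1 ->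
  hess (d1 ++ d2) i <= count_mem north d1.
Proof.
elim: d1 i => [|[] d1 IH] i //=; first by rewrite add0n => di; rewrite add1n ltnS IH.
by case: i => // i di; rewrite IH.
Qed.

(** * Colorings of an indifference graph and the exchange of two colors *)

Section Colorings.

Definition occ (f : nat -> nat) (c l r : nat) := \sum_(l <= i < r) (f i == c).

Lemma occ_cat f c l m r : l <= m <= r -> occ f c l r = occ f c l m + occ f c m r.
Proof. by case/andP=> lm mr; rewrite /occ (big_cat_nat lm mr). Qed.

Lemma occ1 f c i : occ f c i i.+1 = (f i == c).
Proof. by rewrite /occ big_nat1. Qed.

Lemma eq_occ f g c l r : (forall i, l <= i < r -> f i = g i) ->
  occ f c l r = occ g c l r.
Proof. by move=> fg; apply: eq_big_nat => i /fg ->. Qed.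

Lemma occ_gt0 f c l r : 0 < occ f c l r -> exists2 i, l <= i < r & f i = c.
Proof.
rewrite /occ => H.
have [/hasP[i]|/hasPn no] := boolP (has (fun i => f i == c) (index_iota l r)).
  by rewrite mem_index_iota => ? /eqP; exists i.
move: H; rewrite big_seq big1 // => i /no /negbTE -> //.
Qed.

Lemma sum_occ f m l r : l <= r -> (forall i, l <= i < r -> f i < m) ->
  \sum_(c < m) occ f c l r = r - l.
Proof.
move=> lr fm; rewrite /occ exchange_big /= -[RHS]muln1 -sum_nat_const_nat.
apply: eq_big_nat => i /fm fi.
rewrite (bigD1 (Ordinal fi)) //= eqxx big1 // => c.
by rewrite -val_eqE /= eq_sym => /negbTE ->.
Qed.

Variables (n : nat) (H a : nat -> nat).
Hypothesis H_mono : {homo H : i j / i <= j}.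

Definition proper v (f : nat -> nat) :=
  forall i j, i < j < v -> j < H i -> f i != f j.

Definition coloring f := proper n f /\ forall c, occ f c 0 n = a c.

Definition swap_colors (c c' x : nat) :=
  if x == c then c' else if x == c' then c else x.

Definition swap_segment c c' v j (f : nat -> nat) i :=
  if v <= i < j then swap_colors c c' (f i) else f i.

Lemma swap_colorsK c c' : involutive (swap_colors c c').
Proof.
move=> x; rewrite /swap_colors.
have [->|xc] := eqVneq x c.
  by have [->|] := eqVneq c' c; rewrite ?eqxx.
have [->|xc'] := eqVneq x c'; first by rewrite eqxx.
by rewrite (negbTE xc) (negbTE xc').
Qed.

(** An edge inside the segment survives because the swap is injective. An edge that leaves the
    segment has its earlier endpoint in neither color, so the swap fixes the color of that endpoint.
    The weight is kept because both colors are equally frequent in the segment. *)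
Lemma coloring_swap_segment f c c' v j : v <= j <= n -> coloring f ->
  occ f c v j = occ f c' v j ->
  (forall i l, i < v -> v <= l < j -> l < H i -> f i != c /\ f i != c') ->
  (forall i l, v <= i < j -> j <= l < n -> l < H i -> f i != c /\ f i != c') ->
  coloring (swap_segment c c' v j f).
Proof.
move=> /andP[vj jn] [fP fa] cc' Hl Hr.
have fixed x : x != c /\ x != c' -> swap_colors c c' x = x.
  by rewrite /swap_colors => -[/negbTE -> /negbTE ->].
split=> [i l|x].
  move=> /andP[il ln] lH; have ne := fP i l; rewrite il ln in ne.
  have {}ne := ne isT lH; rewrite /swap_segment.
  case: (boolP (v <= i < j)) => vi; case: (boolP (v <= l < j)) => vl //.
  - by rewrite (inj_eq (can_inj (@swap_colorsK _ _))).
  - by rewrite fixed //; apply: (Hr i l) => //; lia.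
  rewrite -(inj_eq (can_inj (@swap_colorsK c c'))) swap_colorsK fixed //.
  by apply: (Hl i l) => //; lia.
rewrite -fa (@occ_cat _ _ 0 v n) ?(@occ_cat _ _ v j n) ?(@occ_cat f _ 0 v n)
  ?(@occ_cat f _ v j n); try lia.
congr (_ + (_ + _)).
- by apply: eq_occ => i iv; rewrite /swap_segment ifN //; lia.
- have -> : occ (swap_segment c c' v j f) x v j = occ f (swap_colors c c' x) v j.
    apply: eq_big_nat => i vi; rewrite /swap_segment vi.
    by rewrite -(inj_eq (can_inj (@swap_colorsK c c'))) swap_colorsK.
  rewrite /swap_colors; case: eqVneq => [->|_] //.
  by case: eqVneq => [->|].
by apply: eq_occ => i iv; rewrite /swap_segment ifN //; lia.
Qed.

(* Swap [f v] and [c'] from [v] on, up to the first vertex [j] at which [c']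
   becomes more frequent than [f v]: each vertex of color [f v] in [v, j) is
   then followed by one of color [c'] = [f j], hence is not adjacent to [j], nor
   to any later vertex. *)
Lemma coloring_exchange f v c' : coloring f -> v < n -> c' != f v ->
  (forall i, i < v -> v < H i -> f i != c') ->
  occ f (f v) v n <= occ f c' v n ->
  exists2 f', coloring f' & (forall i, i < v -> f' i = f i) /\ f' v = c'.
Proof.
move=> fC vn cc' free le_occ; set c := f v in cc' le_occ *.
have [fP fa] := fC.
suff [j vj [Dj right]] : exists2 j, v < j <= n & occ f c v j = occ f c' v j /\
    (forall i l, v <= i < j -> j <= l < n -> l < H i -> f i != c /\ f i != c').
  exists (swap_segment c c' v j f).
    apply: coloring_swap_segment => // [|i l iv vl lH]; first by lia.
    have vH : v < H i by lia.
    by split; [apply: (fP i v); rewrite ?iv|apply: free].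
  split=> [i iv|]; first by rewrite /swap_segment ifN //; lia.
  by rewrite /swap_segment ifT; [rewrite /swap_colors eqxx|lia].
pose excess j := (v < j <= n) && (occ f c v j < occ f c' v j).
have [/asboolP ex|/asboolPn no] := boolP `[< exists j, excess j >]; last first.
  (* If [c'] never overtakes [c], then [le_occ] makes the two counts equal on [v, n), and the swap
     extends to the end. *)
  exists n; first by lia.
  split=> [|i l _]; last by lia.
  apply/eqP; rewrite eqn_leq le_occ leqNgt; apply/negP => lt.
  by apply: no; exists n; rewrite /excess lt; lia.
case: (ex_minnP ex) => j1 /andP[vj1 Ej1] min_j1.
have small j : v <= j < j1 -> occ f c' v j <= occ f c v j.
  move=> vj; rewrite leqNgt; apply/negP => lt.
  have : excess j.
    rewrite /excess lt andbT; have [vj'|] := eqVneq v j; last by lia.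
    by move: lt; rewrite vj' /occ !big_geq.
  by move/min_j1; lia.
(* The first excess arises just after a vertex [j] of color [c'], so the counts agree on [v, j). *)
case: j1 vj1 Ej1 min_j1 small => // j vj1 Ej1 _ small.
have vj : v < j.
  rewrite ltn_neqAle -ltnS; apply/andP; split; last by lia.
  by apply/negP => /eqP vj; move: Ej1; rewrite -vj !occ1 eqxx; lia.
have jn : j < n by lia.
have Ej : occ f c' v j <= occ f c v j by apply: small; lia.
move: Ej1; rewrite (@occ_cat f c v j j.+1) ?(@occ_cat f c' v j j.+1) ?occ1; try lia.
case: (f j =P c') => [fj|_]; last by lia.
rewrite {1}fj (negbTE cc') => Ej1.
have Dj : occ f c v j = occ f c' v j by lia.
exists j; first by lia.
split=> // i l vi jl lH.
have jH : j < H i by lia.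
split; last by rewrite -fj; apply: (fP i j) => //; lia.
apply/eqP => fi.
(* On [v, i) the color [c'] is no more frequent than [c], and [i] has color [c]; equality on [v, j)
   thus forces some [i'] of color [c'] between [i] and [j]. As j < H i <= H i', the vertices [i']
   and [j] would be adjacent with the same color. *)
have : 0 < occ f c' i.+1 j.
  have : occ f c' v i <= occ f c v i by apply: small; lia.
  have cut x : occ f x v j = occ f x v i + ((f i == x) + occ f x i.+1 j).
    by rewrite (@occ_cat _ _ v i j) ?(@occ_cat _ _ i i.+1 j) ?occ1 //; lia.
  by move: Dj; rewrite !cut fi eqxx eq_sym (negbTE cc'); lia.
case/occ_gt0=> i' ii' fi'.
have /eqP[] : f i' != f j; last by rewrite fi' fj.
by apply: fP; [|apply: leq_trans jH (H_mono _)]; lia.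
Qed.

(** * The invariant of the greedy algorithm *)

Variable m : nat.

Definition busy u v (f : nat -> nat) := [seq f i | i <- iota u (v - u)].

(** The vertices below [v] have arrived and those below [u] are retired; [r] gives the remaining
    capacities. [Q] follows the order of the vertices present, while [M] is known only up to order
    and up to the zeros that [extract_max] adds. *)
Definition greedy_state u v f (r : nat -> nat) M Q :=
  [/\ forall c, occ f c 0 v + r c = a c,
      forall i, i < v -> f i < m,
      Q = [seq r c | c <- busy u v f] &
      exists z, perm_eq M
        (nseq z 0 ++ [seq r c | c <- iota 0 m & c \notin busy u v f])].

Lemma busyS u v f : u <= v -> busy u v.+1 f = rcons (busy u v f) (f v).
Proof.
move=> uv; rewrite /busy subSn // -addn1 iotaD map_cat /= cats1.
by rewrite subnKC.
Qed.

Lemma busy_head u v f : u < v -> busy u v f = f u :: busy u.+1 v f.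
Proof. by move=> uv; rewrite /busy -{1}(@subnSK u v). Qed.

Lemma mem_busyP u v f c :
  reflect (exists2 i, u <= i < v & f i = c) (c \in busy u v f).
Proof.
apply: (iffP mapP) => [[i]|[i ui <-]].
  by rewrite mem_iota => ui ->; exists i => //; lia.
by exists i => //; rewrite mem_iota; lia.
Qed.

Lemma eq_busy u v f g : (forall i, i < v -> f i = g i) -> busy u v f = busy u v g.
Proof. by move=> fg; apply/eq_in_map => i; rewrite mem_iota => ui; apply: fg; lia. Qed.

Lemma eq_greedy_state u v f g r M Q : (forall i, i < v -> f i = g i) ->
  greedy_state u v f r M Q -> greedy_state u v g r M Q.
Proof.
move=> fg [occr fm defQ defM]; split.
- by move=> c; rewrite -occr; congr (_ + _); apply: eq_occ => i iv; rewrite fg.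
- by move=> i iv; rewrite -fg ?fm.
- by rewrite -(eq_busy u fg).
- by rewrite -(eq_busy u fg).
Qed.

Lemma perm_filter_notin (s : seq nat) c : c < m -> c \notin s ->
  perm_eq [seq x <- iota 0 m | x \notin s]
    (c :: [seq x <- iota 0 m | x \notin rcons s c]).
Proof.
move=> cm cs; rewrite uniq_perm //; first by rewrite filter_uniq ?iota_uniq.
  by rewrite /= mem_filter mem_rcons inE eqxx /= filter_uniq ?iota_uniq.
move=> x; rewrite inE !mem_filter mem_rcons inE mem_iota.
by have [->|] := eqVneq x c; rewrite ?cs ?cm.
Qed.

Lemma greedy_state_north u v f r M M' Q : u <= v ->
  greedy_state u v f r M Q -> f v < m -> f v \notin busy u v f -> 0 < r (f v) ->
  perm_eq (r (f v) :: M') (0 :: M) ->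
  greedy_state u v.+1 f (fun c => r c - (c == f v)) M' (rcons Q (r (f v)).-1).
Proof.
move=> uv [occr fm defQ [z defM]] fv free r0 MM'; split.
- move=> c; rewrite -occr (@occ_cat f c 0 v v.+1) ?occ1 ?leq0n ?leqnSn // eq_sym.
  by case: (c =P f v) => [->|_]; lia.
- by move=> i; rewrite ltnS leq_eqVlt => /orP[/eqP ->|/fm].
- rewrite busyS // map_rcons eqxx subn1 defQ; congr rcons.
  apply/eq_in_map => c cb; case: eqP => [cf|]; last by rewrite subn0.
  by rewrite cf (negbTE free) in cb.
(* The additional zero is the initial value carried by [extract_max]. *)
exists z.+1; rewrite -(perm_cons (r (f v))) (perm_trans MM') //= perm_sym.
rewrite -cat1s (perm_catCA [:: r (f v)] [:: 0]) /= perm_cons perm_sym.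
rewrite (perm_trans defM) // perm_sym -cat1s perm_catCA perm_cat2l /= perm_sym.
rewrite (perm_trans (perm_map r (perm_filter_notin fv free))) //= perm_cons.
rewrite busyS //.
suff /eq_in_map -> : {in [seq x <- iota 0 m | x \notin rcons (busy u v f) (f v)],
    (fun c => r c - (c == f v)) =1 r} by [].
move=> c; rewrite mem_filter mem_rcons inE negb_or => /andP[/andP[/negbTE -> _] _].
by rewrite subn0.
Qed.

Lemma greedy_state_east u v f r M Q : u < v -> f u \notin busy u.+1 v f ->
  greedy_state u v f r M Q ->
  greedy_state u.+1 v f r (head 0 Q :: M) (behead Q).
Proof.
move=> uv free [occr fm defQ [z defM]]; split=> //.
  by rewrite defQ busy_head.
exists z; rewrite defQ busy_head //= -cat1s.
rewrite -(perm_cat2l [:: r (f u)]) in defM; rewrite (perm_trans defM) //.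
rewrite perm_catCA perm_cat2l perm_sym.
rewrite (perm_trans (perm_map r (@perm_filter_notin _ (f u) (fm u uv) free))) //.
rewrite /= perm_cons perm_map //; apply/permP => p.
congr (count p _); apply: eq_filter => c.
by rewrite mem_rcons -busy_head.
Qed.

End Colorings.

(** * Soundness and completeness of the greedy algorithm *)

Section GreedyCorrect.
Variables (d : seq step) (n : nat) (a : nat -> nat) (m : nat).
Hypothesis d_dyck : is_dyck n d.

Let H := hess d.
Let H_mono : {homo H : i j / i <= j} := @hess_mono d.

Section Prefix.
Variables (d1 d2 : seq step).
Hypothesis def_d : d = d1 ++ d2.
Let u := count_mem east d1.
Let v := count_mem north d1.

Lemma dyck_prefix : u <= v.
Proof.
by have [_ _ /(_ (size d1))] := d_dyck; rewrite def_d take_size_cat.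
Qed.

Lemma dyck_adjacent i : u <= i -> v <= H i.
Proof. by move=> ui; rewrite /H def_d hess_cat_ge // leq_addr. Qed.

Lemma dyck_not_adjacent i : i < u -> H i <= v.
Proof. by move=> ui; rewrite /H def_d hess_cat_lt. Qed.

End Prefix.

Lemma dyck_north d1 d2 : d = d1 ++ north :: d2 -> count_mem north d1 < n.
Proof. by case: d_dyck => <- _ _ ->; rewrite count_cat /=; lia. Qed.

Lemma dyck_east d1 d2 : d = d1 ++ east :: d2 ->
  count_mem east d1 < count_mem north d1.
Proof.
rewrite -cat_rcons => /dyck_prefix; rewrite -cats1 !count_cat /=.
by rewrite !addn0 addn1.
Qed.

(** The vertices present at one time form a clique, so the color that the oldest one releases is
    used by none of the others. *)
Lemma busy_injective d1 d2 f : d = d1 ++ east :: d2 ->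
  proper H (count_mem north d1) f ->
  f (count_mem east d1) \notin busy (count_mem east d1).+1 (count_mem north d1) f.
Proof.
move=> def_d fP; apply/mem_busyP => -[i ui fi].
have /eqP[] : f (count_mem east d1) != f i; last by rewrite fi.
by apply: fP; [|apply: leq_trans (dyck_adjacent def_d (leqnn _))]; lia.
Qed.

(** This links the algorithm to the graph: the earlier neighbors of an arriving vertex are exactly
    the vertices whose east step is still to come, so the colors to avoid are those in [busy]. *)
Lemma adjacent_north d1 d2 i : d = d1 ++ north :: d2 ->
  (count_mem north d1 < H i) = (count_mem east d1 <= i).
Proof.
move=> def_d; have [ui|iu] := leqP (count_mem east d1) i.
  by rewrite /H def_d hess_cat_ge // -addn1 leq_add2l.
by apply/negbTE; rewrite -leqNgt (dyck_not_adjacent def_d).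
Qed.

(** The coloring is built along the accepting run. Capacities may be left over at the end, and [r']
    records them. *)
Lemma greedy_sound d1 d2 f r M Q : d = d1 ++ d2 ->
  proper H (count_mem north d1) f ->
  greedy_state a m (count_mem east d1) (count_mem north d1) f r M Q ->
  greedy d2 M Q ->
  exists g r', [/\ proper H n g, forall i, i < n -> g i < m &
                   forall c, occ g c 0 n + r' c = a c].
Proof.
elim: d2 d1 f r M Q => [|s d2 IH] d1 f r M Q def_d fP St.
  have -> : n = count_mem north d1 by case: d_dyck => <-; rewrite def_d cats0.
  by case: St => occr fm _ _ _; exists f, r; split.
have uv := dyck_prefix def_d.
case: s def_d => def_d /=; last first.
  have := IH (rcons d1 east) f r (head 0 Q :: M) (behead Q).
  rewrite cat_rcons -cats1 !count_cat /= !addn0 addn1; apply => //.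
  apply: greedy_state_east => //; first exact: dyck_east def_d.
  exact: busy_injective def_d fP.
set u := count_mem east d1 in St uv; set v := count_mem north d1 in St fP uv.
have := perm_extract_max 0 M; case: extract_max => M' x /= perm_x /andP[x0].
(* A positive maximum is the capacity of an actual free color, since the spurious entries of [M] are
   0. *)
have [c [cm cb rc]] : exists c, [/\ c < m, c \notin busy u v f & r c = x].
  have [_ _ _ [z defM]] := St.
  have : x \in 0 :: M by rewrite -(perm_mem perm_x) inE eqxx.
  rewrite inE (gtn_eqF x0) (perm_mem defM) mem_cat mem_nseq (gtn_eqF x0) andbF /=.
  case/mapP => c; rewrite mem_filter mem_iota add0n => /andP[cb /= cm] ->.
  by exists c.
pose g i := if i == v then c else f i.
have fg i : i < v -> f i = g i by rewrite /g => iv; rewrite ltn_eqF.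
have gv : g v = c by rewrite /g eqxx.
have := IH (rcons d1 north) g (fun c => r c - (c == g v)) M' (rcons Q x.-1).
rewrite cat_rcons -cats1 !count_cat /= !addn0 addn1 -/u -/v; apply => //.
  move=> i j /andP[ij]; rewrite ltnS leq_eqVlt => /orP[/eqP jv|jv] jH; last first.
    by rewrite -!fg ?fP ?ij //; apply: ltn_trans jv.
  rewrite {j}jv in ij jH *.
  rewrite gv -fg //; apply/eqP => fi; case/mem_busyP: cb; exists i => //.
  by rewrite ij andbT /u -(adjacent_north i def_d).
have {}St := eq_greedy_state fg St.
rewrite -rc -gv; apply: greedy_state_north uv St _ _ _ _; rewrite ?gv ?rc //.
by rewrite -(eq_busy u fg).
Qed.

(** The induction carries a full coloring that agrees with all choices made so far. Where it
    disagrees with the next choice, the exchange replaces it by one that agrees there too, so the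
    algorithm never gets stuck. *)
Lemma greedy_complete d1 d2 f r M Q : d = d1 ++ d2 ->
  coloring n H a f -> (forall i, i < n -> f i < m) ->
  greedy_state a m (count_mem east d1) (count_mem north d1) f r M Q ->
  greedy d2 M Q.
Proof.
elim: d2 d1 f r M Q => [|s d2 IH] d1 f r M Q def_d fC fm St //.
have fP : proper H (count_mem north d1) f.
  move=> i j /andP[ij jv]; apply: fC.1; rewrite ij (leq_trans jv) //.
  by case: d_dyck => <- _ _; rewrite def_d count_cat leq_addr.
have uv := dyck_prefix def_d.
case: s def_d => def_d /=; last first.
  have := IH (rcons d1 east) f r (head 0 Q :: M) (behead Q).
  rewrite cat_rcons -cats1 !count_cat /= !addn0 addn1; apply => //.
  apply: greedy_state_east => //; first exact: dyck_east def_d.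
  exact: busy_injective def_d fP.
have vn := dyck_north def_d.
have adj i := adjacent_north i def_d.
set u := count_mem east d1 in St uv adj; set v := count_mem north d1 in St fP uv vn adj.
have := perm_extract_max 0 M; have := @extract_max_ge 0 M.
case: extract_max => M' x /= max_x perm_x.
(* Since [f] has weight [a], the remaining capacity of a color is its number of occurrences from [v]
   on, which is what the exchange compares. *)
have r_occ c : r c = occ f c v n.
  have [occr _ _ _] := St; apply/eqP.
  by rewrite -(eqn_add2l (occ f c 0 v)) occr -fC.2 -occ_cat // (ltnW vn).
have free_v g : coloring n H a g -> (forall i, i < v -> g i = f i) ->
    g v \notin busy u v f.
  move=> gC gf; apply/mem_busyP => -[i ui fi].
  have /eqP[] : g i != g v by apply: gC.1; rewrite ?adj; lia.
  by rewrite gf //; lia.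
have r_in c : c < m -> c \notin busy u v f -> r c \in M.
  move=> cm cb; have [_ _ _ [z /perm_mem ->]] := St.
  rewrite mem_cat; apply/orP; right; apply: map_f.
  by rewrite mem_filter cb mem_iota.
have r0 : 0 < r (f v) by rewrite r_occ (@occ_cat _ _ v v.+1 n) ?occ1 ?eqxx //; lia.
have rx : r (f v) <= x by apply: max_x; rewrite inE r_in ?orbT ?fm ?free_v.
have x0 : 0 < x by apply: leq_trans rx.
rewrite x0 /=.
have [c [cm cb rc]] : exists c, [/\ c < m, c \notin busy u v f & r c = x].
  have [_ _ _ [z defM]] := St.
  have : x \in 0 :: M by rewrite -(perm_mem perm_x) inE eqxx.
  rewrite inE (gtn_eqF x0) (perm_mem defM) mem_cat mem_nseq (gtn_eqF x0) andbF /=.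
  case/mapP => c; rewrite mem_filter mem_iota add0n => /andP[cb /= cm] ->.
  by exists c.
have [g gC [gf gv]] : exists2 g, coloring n H a g &
    (forall i, i < v -> g i = f i) /\ g v = c.
  have [->|ne] := eqVneq c (f v); first by exists f.
  apply: (coloring_exchange H_mono fC vn ne) => [i iv|]; last by rewrite -!r_occ rc.
  rewrite adj => ui; apply/eqP => fi; case/mem_busyP: cb; exists i => //.
  by rewrite ui.
(* The exchange keeps the weight, so every color of [g] already occurs in [f]. *)
have gm i : i < n -> g i < m.
  move=> iN.
  have : 0 < occ f (g i) 0 n.
    by rewrite fC.2 -gC.2 (@occ_cat _ _ 0 i n) ?(@occ_cat _ _ i i.+1 n) ?occ1 ?eqxx; lia.
  by case/occ_gt0 => j jn <-; apply: fm.
have := IH (rcons d1 north) g (fun c => r c - (c == g v)) M' (rcons Q x.-1).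
rewrite cat_rcons -cats1 !count_cat /= !addn0 addn1 -/u -/v; apply => //.
have {}St := eq_greedy_state (fun i iv => esym (gf i iv)) St.
rewrite -rc -gv; apply: greedy_state_north St _ _ _ _; rewrite // ?gv ?rc //.
by rewrite (eq_busy u gf).
Qed.

End GreedyCorrect.

(** The capacities may come in any order, so the machine is free to store the weights in reverse.
    The condition on the sum makes the weight exact rather than only an upper bound. *)
Lemma greedy_correct n d (w : n.-tuple nat) M : is_dyck n d -> perm_eq M w ->
  chromatic_series (indifference_graph (n := n) d) (nth 0 w) <> 0 <->
  sumn w = n /\ greedy d M [::].
Proof.
move=> d_dyck Mw; pose a := nth 0 w; pose H := hess d.
have H_mono : {homo H : i j / i <= j} := @hess_mono d.
have hE i : i < n -> hessenberg d i.+1 = H i.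
  by move=> iN; apply: hessenbergE; case: d_dyck => _ ->.
have edge (i j : 'I_n) : i < j -> indifference_graph d i j = (j < H i).
  by move=> ij; rewrite /indifference_graph ij (ltnNge j i) (ltnW ij) /= orbF hE.
have sum_a : \sum_(c < n) a c = sumn w.
  by rewrite sumnE (big_nth 0) size_tuple big_mkord.
have init f : greedy_state a n 0 0 f a M [::].
  split=> //; first by move=> c; rewrite /occ big_geq.
  exists 0; rewrite /= filter_predT (perm_trans Mw) //.
  by rewrite -[X in iota 0 X](size_tuple w) map_nth_iota0 // take_size.
pose ext (f : {ffun 'I_n -> nat}) i := if insub i is Some v then f v else n.
have extE f (i : 'I_n) : ext f i = f i by rewrite /ext valK.
have color_occ (f : {ffun 'I_n -> nat}) (g : nat -> nat) c :
    (forall i : 'I_n, g i = f i) ->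
    color_exponent f c = occ g c 0 n.
  move=> gf; rewrite /color_exponent /occ big_mkord -sum1_card big_mkcond /=.
  by apply: eq_bigr => i _; rewrite inE -gf; case: eqP.
have properE (f : {ffun 'I_n -> nat}) (g : nat -> nat) : (forall i : 'I_n, g i = f i) ->
    proper_coloring (indifference_graph (n := n) d) f <-> proper H n g.
  move=> gf; split=> [fP i j /andP[ij jn] jH|gP i j].
    have := fP (Ordinal (ltn_trans ij jn)) (Ordinal jn).
    by rewrite edge //= -!gf /= => /(_ jH) /eqP.
  case: (ltngtP i j) => [ij|ji|/val_inj ->].
  - by rewrite edge // -!gf => jH; apply/eqP; apply: gP => //; rewrite ij /=.
  - rewrite /indifference_graph ji (ltnNge i j) (ltnW ji) /= hE // => iH.
    by rewrite -!gf => /esym; apply/eqP; apply: gP => //; rewrite ji /=.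
  by rewrite /indifference_graph ltnn.
have -> : chromatic_series (indifference_graph (n := n) d) (nth 0 w) <> 0 <->
    exists g, coloring n H a g.
  rewrite /chromatic_series; set C := colorings_of_weight _ _.
  have finC : finite_set C by apply: finite_colorings_of_weight.
  transitivity (exists f, C f).
    split=> [ne|[f Cf] /eqP].
      apply: contrapT => no; apply: ne; apply/eqP; rewrite cardfs_eq0.
      have -> : C = set0 by apply/seteqP; split=> f // Cf; case: no; exists f.
      by rewrite fset_set0.
    rewrite cardfs_eq0 => /eqP E.
    have : f \in fset_set C by rewrite in_fset_set ?mem_set.
    by rewrite E inE.
  split=> [[f [fP fw]]|[g [gP gw]]].
    exists (ext f); split; first exact/(properE f).
    by move=> c; rewrite -(color_occ f) // fw.
  exists [ffun i : 'I_n => g i]; split.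
    by apply/(properE _ g) => // i; rewrite ffunE.
  by move=> c; rewrite (color_occ _ g) ?gw // => i; rewrite ffunE.
split=> [[g gC]|[sum_w]].
  (* Colors from [n] on have weight 0, the default value past the end of [w]. *)
  have gn i : i < n -> g i < n.
    move=> iN; have : 0 < a (g i).
      by rewrite -gC.2 (@occ_cat _ _ 0 i n) ?(@occ_cat _ _ i i.+1 n) ?occ1 ?eqxx; lia.
    by apply: contraLR; rewrite -!leqNgt => ?; rewrite /a nth_default ?size_tuple.
  split.
    rewrite -sum_a -[RHS]subn0 -(sum_occ (leq0n n) gn).
    by apply: eq_bigr => c _; rewrite gC.2.
  exact: (greedy_complete d_dyck (d1 := [::]) erefl gC gn (init g)).
move=> gr.
have P0 : proper H 0 (fun=> 0) by move=> i j; rewrite ltn0 andbF.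
have [g [r [gP gn gr']]] := greedy_sound d_dyck (d1 := [::]) erefl P0 (init _) gr.
exists g; split=> // c.
have [cn|cn] := ltnP c n; last first.
  by have := gr' c; rewrite [a c]nth_default ?size_tuple //; lia.
(* Both the occurrences and the weights sum to [n], so no capacity is left over. *)
have : \sum_(c < n) r c = 0.
  apply/eqP; rewrite -(eqn_add2l (\sum_(c < n) occ g c 0 n)) -big_split /=.
  by rewrite (eq_bigr _ (fun (c : 'I_n) _ => gr' c)) sum_a sum_w sum_occ // subn0 addn0.
move/eqP; rewrite sum_nat_eq0 => /forallP/(_ (Ordinal cn))/eqP /= rc.
by rewrite -gr' rc addn0.
Qed.

(** * The program *)

Section Program.

Local Notation machine := (stack_machine letter 7).
Local Notation heads := {ffun 'I_7 -> option letter}.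

Local Notation one := (letter_bit true).
Local Notation sep := letter_sep.

Local Notation sI := (@Ordinal 7 0 isT).
Local Notation sD := (@Ordinal 7 1 isT).
Local Notation sM := (@Ordinal 7 2 isT).
Local Notation sQ := (@Ordinal 7 3 isT).
Local Notation sX := (@Ordinal 7 4 isT).
Local Notation sY := (@Ordinal 7 5 isT).
Local Notation sT := (@Ordinal 7 6 isT).

Local Notation "p ;; q" := (seqm p q) (at level 61, right associativity).

(** * The subroutines of the machine *)

Definition is_step (l : letter) := if l is inl (inl _) then true else false.
Definition is_bit (l : letter) := if l is inl (inr _) then true else false.

Definition top (p : pred letter) (i : 'I_7) (h : heads) := oapp p false (h i).
Definition nonempty (i : 'I_7) (h : heads) := h i != None.

Definition push i a : machine := op (Push i a).
Definition pop i : machine := op (Pop letter i).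
Definition copy i j : machine :=
  top_op (fun h : heads => if h i is Some a then Push j a else Nop letter 7).
Definition reject : machine := stop _ _ false.
Definition skip : machine := op (Nop letter 7).

Definition pour i j : machine :=
  whilem (nonempty i) (copy i j ;; pop i).

Definition read_path : machine :=
  whilem (top is_step sI)
    (ifm (top (pred1 (letter_step north)) sI)
       (push sQ one ;; push sX one ;; push sY one)
       (ifm (nonempty sX) (pop sX) reject)
     ;; copy sI sD ;; pop sI).

(** The value v on [sX] becomes 2v on [sT], and only the increase v is charged to [sQ]; value and
    budget together keep their sum. *)
Definition double_value : machine :=
  whilem (nonempty sX)
    (pop sX ;; ifm (nonempty sQ) (pop sQ ;; push sT one ;; push sT one) reject).

Definition read_bits : machine :=
  whilem (top is_bit sI)
    (double_value
     ;; ifm (top (pred1 one) sI)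
          (ifm (nonempty sQ) (pop sQ ;; push sT one) reject) skip
     ;; pop sI ;; pour sT sX).

Definition store_weight : machine := push sM sep ;; pour sX sM.

(** Only the digits produced by [bits_of_nat] pass: a numeral with leading digit 1, or the single
    digit 0. *)
Definition read_weight : machine :=
  pop sI ;; pop sY ;;
  ifm (top (pred1 one) sI)
    (ifm (nonempty sQ)
       (pop sI ;; pop sQ ;; push sX one ;; read_bits ;; store_weight) reject)
    (ifm (top is_bit sI)
       (pop sI ;; ifm (top is_bit sI) reject store_weight) reject).

Definition read_weights : machine :=
  whilem (nonempty sI)
    (ifm (top (pred1 sep) sI) (ifm (nonempty sY) read_weight reject) reject).

(** One step of [extract_max], for a maximum x on [sX] and a block m: min(x, m) ones go to [sT], and
    the rest of x joined with the m ones from [sY] gives (x - m) + m = max(x, m) in truncated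
    subtraction. *)
Definition extract_block : machine :=
  whilem (top (pred1 one) sM)
    (pop sM ;; push sY one ;; ifm (nonempty sX) (pop sX ;; push sT one) skip)
  ;; pop sM ;; push sT sep ;; pour sY sX.

Definition extract : machine :=
  whilem (nonempty sM) extract_block ;; pour sT sM.

(** The queue has its oldest entry on top, so a new entry goes to the bottom of [sQ], which is
    reached by pouring onto [sT] and back. *)
Definition assign : machine :=
  extract ;;
  ifm (nonempty sX)
    (pop sX ;; pour sQ sT ;; pour sX sT ;; push sT sep ;; pour sT sQ)
    reject.

Definition release : machine :=
  push sM sep ;; whilem (top (pred1 one) sQ) (pop sQ ;; push sM one) ;; pop sQ.

Definition color_path : machine :=
  whilem (nonempty sI)
    (ifm (top (pred1 (letter_step north)) sI)
       (pop sI ;; assign) (pop sI ;; release)).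

(* The input is on stack [sI]; the path is copied to [sD], while [sQ], [sX] and
   [sY] hold in unary the sum still allowed for the weights, the height of the
   path (later the weight being read), and the number of missing weights. The
   stacks [sM] and [sQ] then hold the two lists of [greedy]. *)
Definition decide : machine :=
  read_path ;;
  ifm (nonempty sX) reject
    (read_weights ;;
     ifm (fun h : heads => nonempty sQ h || nonempty sY h) reject
       (pour sD sI ;; color_path ;; stop _ _ true)).

(** * Unary stack contents and basic instructions *)

Definition unary (n : nat) : seq letter := nseq n one.

Definition unaries (L : seq nat) : seq letter :=
  flatten [seq rcons (unary n) sep | n <- L].

Arguments unary : simpl never.
Arguments unaries : simpl never.

Lemma unaries_cons n L : unaries (n :: L) = unary n ++ sep :: unaries L.
Proof. by rewrite /unaries /= cat_rcons. Qed.

Lemma topE p (i : 'I_7) (s : store letter) :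
  top p i (tops 7 s) = oapp p false (ohead (nth [::] s i)).
Proof. by rewrite /top ffunE. Qed.

Lemma nonemptyE (i : 'I_7) (s : store letter) :
  nonempty i (tops 7 s) = (nth [::] s i != [::]).
Proof. by rewrite /nonempty ffunE; case: (nth [::] s i). Qed.

Lemma exec_pop i s : exec (pop i) s 1 (inl (stack_act (Pop letter i) s)).
Proof. exact: exec_op. Qed.

Lemma exec_push i a s : exec (push i a) s 1 (inl (stack_act (Push i a) s)).
Proof. exact: exec_op. Qed.

Lemma exec_skip s : exec skip s 1 (inl s).
Proof. exact: exec_op. Qed.

Lemma exec_reject s : exec reject s 1 (inr false).
Proof. exact: exec_stop. Qed.

Ltac exec_next := eapply exec_seqm;
  [first [exact: exec_pop | exact: exec_push | exact: exec_skip]|].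

Lemma exec_copy (i j : 'I_7) s a w : nth [::] s i = a :: w ->
  exec (copy i j) s 1 (inl (set_nth [::] s j (a :: nth [::] s j))).
Proof.
move=> si; have := exec_top_op
  (fun h : heads => if h i is Some a then Push j a else Nop letter 7) s.
by rewrite ffunE si.
Qed.

Lemma set_nth_id (T : Type) (x : T) s i : i < size s -> set_nth x s i (nth x s i) = s.
Proof. by elim: s i => [|y s IH] [|i] //= /IH ->. Qed.

Lemma exec_pour (i j : 'I_7) s : i != j -> size s = 7 ->
  exec (pour i j) s (3 * size (nth [::] s i)).+1
    (inl (set_nth [::]
            (set_nth [::] s j (catrev (nth [::] s i) (nth [::] s j))) i [::])).
Proof.
move=> ij; have ij' : (val i == val j) = false by apply/negbTE.
move Ew: (nth [::] s i) => w; elim: w s Ew => [|a w IH] s si ss.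
  rewrite /= set_nth_id ?ss // -[X in set_nth _ _ _ X]si set_nth_id ?ss //.
  by apply: exec_whilem_done; rewrite nonemptyE si.
pose s1 := set_nth [::] (set_nth [::] s j (a :: nth [::] s j)) i w.
have s1i : nth [::] s1 i = w by rewrite nth_set_nth /= eqxx.
have s1j : nth [::] s1 j = a :: nth [::] s j.
  by rewrite nth_set_nth /= [_ == _]eq_sym ij' nth_set_nth /= eqxx.
have size_set r (l : 'I_7) w' : size r = 7 -> size (set_nth [::] r l w') = 7.
  by move=> sr; rewrite size_set_nth sr; have := ltn_ord l; lia.
have ss1 : size s1 = 7 by rewrite !size_set.
have {IH} := IH s1 s1i ss1; rewrite s1j.
have -> : set_nth [::] (set_nth [::] s1 j (catrev w (a :: nth [::] s j))) i [::] =
    set_nth [::] (set_nth [::] s j (catrev w (a :: nth [::] s j))) i [::].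
  apply: (@eq_from_nth _ [::]) => [|l _]; first by rewrite !size_set.
  rewrite !nth_set_nth /= !nth_set_nth /= !nth_set_nth /=.
  have [//|li] := eqVneq l i; have [//|lj] := eqVneq l j.
  by rewrite nth_set_nth /= (negbTE lj) //.
have -> : s1 = stack_act (Pop letter i) (set_nth [::] s j (a :: nth [::] s j)).
  by rewrite /= nth_set_nth /= ij' si.
move=> IH.
apply: exec_weaken (exec_whilem _ (exec_seqm (exec_copy j si) (exec_pop _ _)) IH).
  by rewrite /=; lia.
by rewrite nonemptyE si.
Qed.

Lemma catrev_unary n m : catrev (unary n) (unary m) = unary (n + m).
Proof.
elim: n m => //= n IH m.
by rewrite -[one :: unary m]/(unary m.+1) -[LHS]/(catrev (unary n) _) IH addnS.
Qed.

(** * Reading the path *)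

Fixpoint ballot (x : nat) (d : seq step) : bool :=
  match d with
  | [::] => true
  | north :: d' => ballot x.+1 d'
  | east :: d' => (0 < x) && ballot x.-1 d'
  end.

Definition starts (T : Type) (p : pred T) (s : seq T) := oapp p false (ohead s).

Lemma exec_read_path d rest D M q x y T : ~~ starts is_step rest ->
  exec read_path [:: map letter_step d ++ rest; D; M; unary q; unary x; unary y; T]
    (10 * size d).+1
    (if ballot x d
     then inl [:: rest; catrev (map letter_step d) D; M;
                  unary (count_mem north d + q);
                  unary (x + count_mem north d - count_mem east d);
                  unary (count_mem north d + y); T]
     else inr false).
Proof.
move=> nstep; elim: d D q x y => [|[] d IH] D q x y.
- rewrite /= addn0 subn0; apply: exec_weaken (exec_whilem_done _ _) => //.
  by rewrite topE.
- have {}IH := IH (letter_step north :: D) q.+1 x.+1 y.+1.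
  rewrite !addnS addSn in IH.
  have -> : count_mem north (north :: d) = (count_mem north d).+1 by [].
  have -> : count_mem east (north :: d) = count_mem east d by [].
  rewrite !addSn addnS.
  apply: exec_weaken; last first.
    eapply exec_whilem; [by rewrite topE| |exact: IH].
    eapply exec_seqm.
      eapply exec_ifm_true; first by rewrite topE.
      by exec_next; exec_next; exact: exec_push.
    by eapply exec_seqm; [eapply exec_copy; reflexivity | exact: exec_pop].
  by rewrite /=; lia.
case: x => [|x] /=.
  apply: exec_weaken; last first.
    eapply exec_whilem_stop; first by rewrite topE.
    eapply exec_seqm_stop, exec_ifm_false; first by rewrite topE.
    eapply exec_ifm_false; first by rewrite nonemptyE.
    exact: exec_reject.
  by rewrite /=; lia.
rewrite add0n addSn add1n subSS.
have {}IH := IH (letter_step east :: D) q x y.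
apply: exec_weaken; last first.
  eapply exec_whilem; [by rewrite topE| |exact: IH].
  eapply exec_seqm.
    eapply exec_ifm_false; first by rewrite topE.
    eapply exec_ifm_true; first by rewrite nonemptyE.
    exact: exec_pop.
  by eapply exec_seqm; [eapply exec_copy; reflexivity | exact: exec_pop].
by rewrite /=; lia.
Qed.

(** * Reading binary digits within the budget *)

Lemma exec_double_value I D M q v Y t :
  exec double_value [:: I; D; M; unary q; unary v; Y; unary t] (10 * v).+1
    (if v <= q
     then inl [:: I; D; M; unary (q - v); [::]; Y; unary (v.*2 + t)]
     else inr false).
Proof.
elim: v q t => [|v IH] q t.
  by rewrite subn0; apply: exec_weaken (exec_whilem_done _ _); rewrite ?nonemptyE.
case: q => [|q].
  apply: exec_weaken; last first.
    eapply exec_whilem_stop; first by rewrite nonemptyE.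
    exec_next; eapply exec_ifm_false; first by rewrite nonemptyE.
    exact: exec_reject.
  by lia.
have {}IH := IH q t.+2; rewrite !addnS in IH.
rewrite ltnS subSS doubleS !addSn.
apply: exec_weaken; last first.
  eapply exec_whilem; [by rewrite nonemptyE| |exact: IH].
  exec_next; eapply exec_ifm_true; first by rewrite nonemptyE.
  by exec_next; exec_next; exact: exec_push.
by lia.
Qed.

Definition bits_value (v : nat) (bs : seq bool) : nat :=
  foldl (fun v (b : bool) => v.*2 + b) v bs.

Lemma bits_value_ge v bs : v <= bits_value v bs.
Proof.
elim: bs v => //= b bs IH v; apply: leq_trans (IH _).
by rewrite -addnn -addnA leq_addr.
Qed.

(** As 0 < v, each completed round lowers q while v + q stays the same. This bounds the time in
    terms of v and q alone, whatever the number of digits. *)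
Lemma exec_read_bits bs rest D M q v Y : 0 < v -> ~~ starts is_bit rest ->
  exec read_bits
    [:: map letter_bit bs ++ rest; D; M; unary q; unary v; Y; [::]]
    (30 * (v + q).+1 * q.+1)
    (if bits_value v bs <= v + q
     then inl [:: rest; D; M; unary (v + q - bits_value v bs);
                  unary (bits_value v bs); Y; [::]]
     else inr false).
Proof.
move=> v0 nbit; elim: bs q v v0 => [|b bs IH] q v v0.
  rewrite /= leq_addr addKn; apply: exec_weaken (exec_whilem_done _ _); first by lia.
  by rewrite topE.
rewrite [bits_value _ _]/=.
have loop : top is_bit sI (tops 7
    [:: map letter_bit (b :: bs) ++ rest; D; M; unary q; unary v; Y; [::]]).
  by rewrite topE.
have dbl := exec_double_value (map letter_bit (b :: bs) ++ rest) D M q v Y 0.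
have [small|large] := leqP (v + b) q; last first.
  (* The next value 2v + b already exceeds v + q, and further digits never lower it. *)
  rewrite leqNgt (leq_trans _ (bits_value_ge _ _)) /=; last by lia.
  case: leqP dbl => [vq|_] dbl; last first.
    apply: exec_weaken (exec_whilem_stop loop (exec_seqm_stop _ dbl)).
    by nia.
  (* The budget covers the doubling but not the digit. *)
  have {large}[bT qv] : b = true /\ q = v by case: b {loop dbl} large; lia.
  rewrite {b}bT {q}qv subnn in loop dbl vq *.
  apply: exec_weaken; last first.
    eapply (exec_whilem_stop loop); eapply exec_seqm; first exact: dbl.
    eapply exec_seqm_stop, exec_ifm_true; first by rewrite topE.
    eapply exec_ifm_false; first by rewrite nonemptyE.
    exact: exec_reject.
  by nia.
rewrite ifT in dbl; last by lia.
have {}IH := IH (q - v - b) (v.*2 + b).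
have E : v.*2 + b + (q - v - b) = v + q by lia.
rewrite E in IH.
have step : exec (ifm (top (pred1 one) sI)
      (ifm (nonempty sQ) (pop sQ ;; push sT one) reject) skip)
    [:: map letter_bit (b :: bs) ++ rest; D; M; unary (q - v); [::]; Y;
        unary (v.*2 + 0)]
    4 (inl [:: map letter_bit (b :: bs) ++ rest; D; M; unary (q - v - b); [::]; Y;
               unary (v.*2 + b)]).
  case: b {IH E dbl loop} small => small.
    have : 0 < q - v by rewrite subn_gt0; lia.
    case: (q - v) => // k _; rewrite [_ - true]subn1 [_ + true]addn1 addn0.
    apply: exec_weaken; last first.
      eapply exec_ifm_true; first by rewrite topE.
      eapply exec_ifm_true; first by rewrite nonemptyE.
      by exec_next; exact: exec_push.
    by [].
  rewrite subn0; apply: exec_weaken; last first.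
    by eapply exec_ifm_false; [rewrite topE|exact: exec_skip].
  by [].
have pourT := @exec_pour sT sX
  [:: map letter_bit bs ++ rest; D; M; unary (q - v - b); [::]; Y;
      unary (v.*2 + b)] isT erefl.
rewrite /= (catrev_unary _ 0) addn0 size_nseq in pourT.
apply: exec_weaken; last first.
  eapply (exec_whilem loop); last by apply: IH; lia.
  eapply exec_seqm; first exact: dbl.
  eapply exec_seqm; first exact: step.
  by exec_next; exact: pourT.
(* The first summand is the factor in the bound of the remaining rounds; the second, v + b >= 1,
   pays for this round. *)
have -> : q.+1 = (q - v - b).+1 + (v + b) by lia.
have : 30 * (v + q).+1 <= 30 * (v + q).+1 * (v + b) by rewrite leq_pmulr //; lia.
have : b <= 1 by case: (b). lia.
Qed.

Lemma exec_store_weight I D L Q v Y :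
  exec store_weight [:: I; D; unaries L; Q; unary v; Y; [::]] (10 * v.+1)
    (inl [:: I; D; unaries (v :: L); Q; [::]; Y; [::]]).
Proof.
have pourX := @exec_pour sX sM
  [:: I; D; sep :: unaries L; Q; unary v; Y; [::]] isT erefl.
rewrite /= size_nseq in pourX.
have -> : unaries (v :: L) = catrev (unary v) (sep :: unaries L).
  by rewrite catrevE rev_nseq unaries_cons.
apply: exec_weaken; last by exec_next; exact: pourX.
by lia.
Qed.

(** * Binary numerals *)

Lemma bits_of_nat_double m (b : bool) : 0 < m ->
  bits_of_nat (m.*2 + b) = rcons (bits_of_nat m) b.
Proof.
move=> m0; have := bin_of_natK m; rewrite /bits_of_nat.
case: (bin_of_nat m) => [|p] /= mp; first by rewrite -mp in m0.
have -> : m.*2 + b =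
    nat_of_bin (BinNums.Npos (if b then BinNums.xI p else BinNums.xO p)).
  by rewrite -mp; case: b => /=; rewrite ?addn1 ?addn0 ?NatTrec.doubleE.
by rewrite nat_of_binK; case: b.
Qed.

Lemma bits_of_bits_value bs : bits_of_nat (bits_value 1 bs) = true :: bs.
Proof.
elim/last_ind: bs => // bs b IH.
by rewrite /bits_value foldl_rcons bits_of_nat_double ?IH // bits_value_ge.
Qed.

Lemma bits_value_surj m : 0 < m -> exists bs, bits_value 1 bs = m.
Proof.
elim/ltn_ind: m => m IH m0; have [m1|m1] := leqP m 1.
  by exists [::]; case: m m0 m1 {IH} => [|[]].
have [||bs bsm] := IH m./2; [by lia|by lia|].
exists (rcons bs (odd m)); rewrite /bits_value foldl_rcons -/(bits_value _ _) bsm.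
by rewrite addnC odd_double_half.
Qed.

Variant bits_of_nat_spec : nat -> seq bool -> Type :=
| BitsOfZero : bits_of_nat_spec 0 [:: false]
| BitsOfPos bs : bits_of_nat_spec (bits_value 1 bs) (true :: bs).

Lemma bits_of_natP m : bits_of_nat_spec m (bits_of_nat m).
Proof.
case: m => [|m]; first exact: BitsOfZero.
have /cid[bs <-] := bits_value_surj (ltn0Sn m).
rewrite bits_of_bits_value; exact: BitsOfPos.
Qed.

(** * Unique decoding of words *)

Lemma span_inj (T : Type) (p : pred T) s1 s2 r1 r2 : all p s1 -> all p s2 ->
  ~~ starts p r1 -> ~~ starts p r2 -> s1 ++ r1 = s2 ++ r2 -> s1 = s2 /\ r1 = r2.
Proof.
elim: s1 s2 => [|x s1 IH] [|y s2] //=.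
- by move=> _ /andP[py _] nr1 _ E; case/negP: nr1; rewrite E.
- by move=> /andP[px _] _ _ nr2 E; case/negP: nr2; rewrite -E.
move=> /andP[_ s1p] /andP[_ s2p] nr1 nr2 [-> E].
by have [-> ->] := IH _ s1p s2p nr1 nr2 E.
Qed.

Lemma span_exists (A T : Type) (f : A -> T) (p : pred T) w :
  (forall x, p x -> exists a, x = f a) ->
  exists s r, w = map f s ++ r /\ ~~ starts p r.
Proof.
move=> fp; elim: w => [|x w [s [r [-> nr]]]]; first by exists [::], [::].
have [/fp[a ->]|npx] := boolP (p x); first by exists (a :: s), r.
by exists [::], (x :: map f s ++ r).
Qed.

Definition encode_weights (w : seq nat) : seq letter :=
  flatten [seq encode_weight a | a <- w].

Lemma encode_weights_bit w : ~~ starts is_bit (encode_weights w).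
Proof. by case: w. Qed.

Lemma encode_weights_step w : ~~ starts is_step (encode_weights w).
Proof. by case: w. Qed.

Lemma all_bit bs : all is_bit (map letter_bit bs).
Proof. by elim: bs. Qed.

Lemma all_step d : all is_step (map letter_step d).
Proof. by elim: d. Qed.

Lemma letter_bit_inj : injective letter_bit.
Proof. by move=> b1 b2 []. Qed.

Lemma letter_step_inj : injective letter_step.
Proof. by move=> b1 b2 []. Qed.

Lemma encode_weights_sep bs rest w : ~~ starts is_bit rest ->
  sep :: map letter_bit bs ++ rest = encode_weights w ->
  exists a w', [/\ w = a :: w', bs = bits_of_nat a & rest = encode_weights w'].
Proof.
move=> nbit; case: w => // a w [E]; exists a, w.
have [/(inj_map letter_bit_inj) -> ->] // := span_inj (all_bit _) (all_bit _) nbit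
  (encode_weights_bit w) E.
Qed.

Lemma encode_weights_inj : injective encode_weights.
Proof.
elim=> [|a w IH] [|b w'] // E.
have [c [w'' [[-> <-] ab /IH <-]]] := encode_weights_sep (encode_weights_bit w) E.
congr cons; case: (bits_of_natP a) ab; case: (bits_of_natP c) => //.
by move=> bs1 bs2 [->].
Qed.

(** A rejection means that the digits are no numeral of [bits_of_nat] or denote a number above the
    budget; q < a covers both, vacuously in the first case. *)
Lemma exec_read_weight bs rest D L q y : ~~ starts is_bit rest ->
  let s := [:: sep :: map letter_bit bs ++ rest; D; unaries L; unary q; [::];
               unary y.+1; [::]] in
  let t := 60 * (q.+1 * q.+1) in
  (exists a, [/\ bs = bits_of_nat a, a <= q &
     exec read_weight s t (inl [:: rest; D; unaries (a :: L); unary (q - a);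
                                   [::]; unary y; [::]])]) \/
  (exec read_weight s t (inr false) /\ forall a, bs = bits_of_nat a -> q < a).
Proof.
move=> nbit s t.
have start M r : exec M [:: map letter_bit bs ++ rest; D; unaries L; unary q; [::];
    unary y; [::]] (50 * (q.+1 * q.+1)) r -> exec (pop sI ;; pop sY ;; M) s t r.
  move=> Mr; apply: exec_weaken; last by exec_next; exec_next; exact: Mr.
  by rewrite /t; nia.
case: bs @s start => [|[] bs] s start.
- right; split; last by move=> a; case: bits_of_natP.
  apply: start; apply: exec_weaken; last first.
    have restP (p : pred letter) : (forall l, p l -> is_bit l) ->
        ~~ top p sI (tops 7 [:: rest; D; unaries L; unary q; [::]; unary y; [::]]).
      rewrite topE; move: nbit; rewrite /starts /=; case: (ohead rest) => //= l nl pl.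
      by apply: contra nl; apply: pl.
    eapply exec_ifm_false; first by apply: restP => l /eqP ->.
    by eapply exec_ifm_false; [apply: restP | exact: exec_reject].
  by nia.
- case: q @t @s start => [|q] t s start.
    right; split; last by move=> a; case: bits_of_natP => // bs' _; apply: bits_value_ge.
    apply: start; apply: exec_weaken; last first.
      eapply exec_ifm_true; first by rewrite topE.
      by eapply exec_ifm_false; [rewrite nonemptyE | exact: exec_reject].
    by nia.
  have bitsP := @exec_read_bits bs rest D (unaries L) q 1 (unary y) isT nbit.
  rewrite add1n in bitsP; case: leqP bitsP => [le_q|gt_q] bitsP.
    left; exists (bits_value 1 bs); split; rewrite ?bits_of_bits_value //.
    apply: start; apply: exec_weaken; last first.
      eapply exec_ifm_true; first by rewrite topE.
      eapply exec_ifm_true; first by rewrite nonemptyE.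
      exec_next; exec_next; exec_next; eapply exec_seqm; first exact: bitsP.
      exact: exec_store_weight.
    by nia.
  right; split.
    apply: start; apply: exec_weaken; last first.
      eapply exec_ifm_true; first by rewrite topE.
      eapply exec_ifm_true; first by rewrite nonemptyE.
      exec_next; exec_next; exec_next; eapply exec_seqm_stop; exact: bitsP.
    by nia.
  by move=> a; case: bits_of_natP => // bs' [<-].
case: bs @s start => [|b bs] s start.
  left; exists 0; split=> //; rewrite subn0.
  apply: start; apply: exec_weaken; last first.
    eapply exec_ifm_false; first by rewrite topE.
    eapply exec_ifm_true; first by rewrite topE.
    exec_next; eapply exec_ifm_false; first by rewrite topE.
    exact: (exec_store_weight _ _ _ _ 0).
  by nia.
right; split; last by move=> a; case: bits_of_natP.
apply: start; apply: exec_weaken; last first.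
  eapply exec_ifm_false; first by rewrite topE.
  eapply exec_ifm_true; first by rewrite topE.
  by exec_next; eapply exec_ifm_true; [rewrite topE | exact: exec_reject].
by nia.
Qed.

(** Induction on the number y of missing weights. The fixed bound [N] on the budget gives every
    weight the same cost bound, so the total is linear in y. *)
Lemma exec_read_weights rest D L q y N : q <= N ->
  let s := [:: rest; D; unaries L; unary q; [::]; unary y; [::]] in
  let t := 100 * y.+1 * (N.+1 * N.+1) in
  (exists w, [/\ rest = encode_weights w, sumn w <= q, size w <= y &
     exec read_weights s t (inl [:: [::]; D; unaries (catrev w L);
       unary (q - sumn w); [::]; unary (y - size w); [::]])]) \/
  (exec read_weights s t (inr false) /\
   forall w, rest = encode_weights w -> sumn w <= q -> size w <= y -> False).
Proof.
elim: y q rest L => [|y IH] q rest L qN s t.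
all: case: rest @s => [|l rest] s; [left; exists [::]; rewrite subn0 subn0; split=> //;
  by apply: exec_weaken (exec_whilem_done _ _); rewrite ?nonemptyE // /t; nia|].
all: have loop : nonempty sI (tops 7 s) by rewrite nonemptyE.
all: have [lsep|nsep] := eqVneq l sep; last (right; split; last
  by case=> // a w [lE]; rewrite lE eqxx in nsep).
- right; split; last by case.
  apply: exec_weaken; last first.
    eapply (exec_whilem_stop loop), exec_ifm_true; first by rewrite topE /= lsep.
    by eapply exec_ifm_false; [rewrite nonemptyE | exact: exec_reject].
  by rewrite /t; nia.
- apply: exec_weaken; last first.
    eapply (exec_whilem_stop loop), exec_ifm_false; first by rewrite topE.
    exact: exec_reject.
  by rewrite /t; nia.
- have [bs [rest' [def_rest nbit]]] : exists bs r,
      rest = map letter_bit bs ++ r /\ ~~ starts is_bit r.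
    by apply: span_exists => -[[|b]|] // _; exists b.
  subst l rest.
  have [[a [bsE aq Ha]]|[Hs no]] := exec_read_weight bs D L q y nbit; last first.
    right; split.
      apply: exec_weaken; last first.
        eapply (exec_whilem_stop loop), exec_ifm_true; first by rewrite topE.
        by eapply exec_ifm_true; [rewrite nonemptyE | exact: Hs].
      by rewrite /t; nia.
    move=> w /(encode_weights_sep nbit)[a [w' [-> /no aq _]]] /=; lia.
  have qaN : q - a <= N by lia.
  have := IH (q - a) rest' (a :: L) qaN; cbv zeta.
  have body r : exec read_weights [:: rest'; D; unaries (a :: L); unary (q - a);
      [::]; unary y; [::]] (100 * y.+1 * (N.+1 * N.+1)) r -> exec read_weights s t r.
    move=> Hr; apply: exec_weaken; last first.
      eapply (exec_whilem loop); last exact: Hr.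
      eapply exec_ifm_true; first by rewrite topE.
      by eapply exec_ifm_true; [rewrite nonemptyE | exact: Ha].
    by rewrite /t; nia.
  case=> [[w [rE wq wy Hw]]|[Hs no]].
    left; exists (a :: w); split=> //=; [by rewrite rE bsE|lia|].
    by rewrite subSS subnDA; apply: body.
  right; split; first exact: body.
  move=> w /(encode_weights_sep nbit)[b [w' [-> bE restE]]] /= wq wy.
  have ab : a = b.
    have : encode_weights [:: a] = encode_weights [:: b].
      by rewrite /encode_weights /encode_weight /= -bsE -bE.
    by move/encode_weights_inj => [].
  by apply: (no w' restE); lia.
- apply: exec_weaken; last first.
    eapply (exec_whilem_stop loop), exec_ifm_false; first by rewrite topE.
    exact: exec_reject.
  by rewrite /t; nia.
Qed.

(** * The greedy algorithm on the stacks *)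

Lemma unary_cat_one n w : unary n ++ one :: w = unary n.+1 ++ w.
Proof. by elim: n => //= n IH; rewrite -[LHS]/(one :: unary n ++ _) IH. Qed.

Lemma size_unaries L : size (unaries L) = sumn L + size L.
Proof.
by elim: L => // n L IH; rewrite unaries_cons size_cat size_nseq /= IH; lia.
Qed.

Lemma unaries_rcons L n : unaries (rcons L n) = unaries L ++ rcons (unary n) sep.
Proof. by rewrite /unaries map_rcons flatten_rcons. Qed.

Lemma unaries_eq0 L : (unaries L == [::]) = (L == [::]).
Proof. by case: L => // n L; rewrite unaries_cons; case: n. Qed.

Lemma exec_extract_block I D M Q m x T :
  exec extract_block [:: I; D; unary m ++ sep :: M; Q; unary x; [::]; T]
    (20 * m.+1)
    (inl [:: I; D; M; Q; unary (maxn x m); [::]; sep :: unary (minn x m) ++ T]).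
Proof.
have inner m' x' y T' : exec (whilem (top (pred1 one) sM)
      (pop sM ;; push sY one ;; ifm (nonempty sX) (pop sX ;; push sT one) skip))
    [:: I; D; unary m' ++ sep :: M; Q; unary x'; unary y; T'] (10 * m').+1
    (inl [:: I; D; sep :: M; Q; unary (x' - m'); unary (m' + y);
             unary (minn x' m') ++ T']).
  elim: m' x' y T' => [|m' IH] x' y T'.
    rewrite subn0 minn0; apply: exec_weaken (exec_whilem_done _ _) => //.
    by rewrite topE.
  case: x' => [|x'].
    have {}IH := IH 0 y.+1 T'; rewrite sub0n min0n addnS in IH.
    apply: exec_weaken; last first.
      eapply exec_whilem; [by rewrite topE| |exact: IH].
      exec_next; exec_next.
      by eapply exec_ifm_false; [rewrite nonemptyE | exact: exec_skip].
    by lia.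
  have {}IH := IH x' y.+1 (one :: T').
  rewrite unary_cat_one -minnSS addnS in IH; rewrite subSS.
  apply: exec_weaken; last first.
    eapply exec_whilem; [by rewrite topE| |exact: IH].
    exec_next; exec_next; eapply exec_ifm_true; first by rewrite nonemptyE.
    by exec_next; exact: exec_push.
  by lia.
have pourY := @exec_pour sY sX
  [:: I; D; M; Q; unary (x - m); unary m; sep :: unary (minn x m) ++ T] isT erefl.
rewrite /= catrev_unary -maxnE maxnC size_nseq in pourY.
have {}inner := inner m x 0 T; rewrite addn0 in inner.
apply: exec_weaken; last first.
  eapply exec_seqm; first exact: inner.
  by exec_next; exec_next; exact: pourY.
by lia.
Qed.

Lemma exec_extract I D L Q :
  exec extract [:: I; D; unaries L; Q; [::]; [::]; [::]]
    (30 * (size (unaries L)).+1)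
    (inl [:: I; D; unaries (extract_max 0 L).1; Q; unary (extract_max 0 L).2;
             [::]; [::]]).
Proof.
have loop M x T : exec (whilem (nonempty sM) extract_block)
    [:: I; D; unaries M; Q; unary x; [::]; T] (25 * size (unaries M)).+1
    (inl [:: I; D; [::]; Q; unary (extract_max x M).2; [::];
             catrev (unaries (extract_max x M).1) T]).
  elim: M x T => [|m M IH] x T.
    by apply: exec_weaken (exec_whilem_done _ _); rewrite ?nonemptyE.
  have {}IH := IH (maxn x m) (sep :: unary (minn x m) ++ T).
  rewrite [extract_max x _]/=; case: extract_max IH => M' x' /= IH.
  rewrite (unaries_cons (minn x m)) catrevE rev_cat rev_cons rev_nseq -cats1 -!catA /= -catrevE.
  apply: exec_weaken; last first.
    eapply exec_whilem; [|rewrite unaries_cons; exact: exec_extract_block|exact: IH].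
    by rewrite nonemptyE /= unaries_eq0.
  by rewrite unaries_cons size_cat size_nseq /=; lia.
have sz : size (unaries (extract_max 0 L).1) <= size (unaries L).
  rewrite !size_unaries size_extract_max leq_add2r -[sumn L]add0n -sumn_extract_max.
  exact: leq_addl.
have pourT := @exec_pour sT sM
  [:: I; D; [::]; Q; unary (extract_max 0 L).2; [::];
      catrev (unaries (extract_max 0 L).1) [::]] isT erefl.
rewrite /= !catrevE !cats0 revK size_rev in pourT.
have {}loop := loop L 0 [::]; rewrite catrevE cats0 in loop.
apply: exec_weaken (exec_seqm loop pourT).
apply: (leq_trans (n := (25 * size (unaries L)).+1 + (3 * size (unaries L)).+1));
  last by lia.
by rewrite leq_add2l ltnS leq_mul2l sz.
Qed.

Lemma exec_assign I D M Q :
  exec assign [:: I; D; unaries M; unaries Q; [::]; [::]; [::]]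
    (100 * (size (unaries M) + size (unaries Q)).+1)
    (let: (M', x) := extract_max 0 M in
     if 0 < x
     then inl [:: I; D; unaries M'; unaries (rcons Q x.-1); [::]; [::]; [::]]
     else inr false).
Proof.
have := exec_extract I D M (unaries Q); have := sumn_extract_max 0 M.
case: extract_max => M' [|x] /= sum_x ext.
  apply: exec_weaken; last first.
    eapply exec_seqm; first exact: ext.
    by eapply exec_ifm_false; [rewrite nonemptyE | exact: exec_reject].
  by lia.
have xM : x <= size (unaries M) by rewrite size_unaries; lia.
have pourQ := @exec_pour sQ sT
  [:: I; D; unaries M'; unaries Q; unary x; [::]; [::]] isT erefl.
have pourX := @exec_pour sX sT
  [:: I; D; unaries M'; [::]; unary x; [::]; catrev (unaries Q) [::]] isT erefl.
have pourT := @exec_pour sT sQ [:: I; D; unaries M'; [::]; [::]; [::];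
  sep :: catrev (unary x) (catrev (unaries Q) [::])] isT erefl.
rewrite /= !size_nseq in pourQ pourX pourT.
rewrite unaries_rcons.
have E : catrev (catrev (unary x) (catrev (unaries Q) [::])) [:: sep] =
    unaries Q ++ rcons (unary x) sep.
  by rewrite !catrevE cats0 rev_cat !revK -catA cats1.
rewrite E in pourT.
apply: exec_weaken; last first.
  eapply exec_seqm; first exact: ext.
  eapply exec_ifm_true; first by rewrite nonemptyE.
  exec_next; eapply exec_seqm; first exact: pourQ.
  eapply exec_seqm; first exact: pourX.
  by exec_next; exact: pourT.
rewrite size_unaries in xM.
by rewrite !catrevE cats0 size_cat !size_rev size_nseq !size_unaries; lia.
Qed.

Lemma exec_release I D M Q :
  exec release [:: I; D; unaries M; unaries Q; [::]; [::]; [::]]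
    (10 * (size (unaries Q)).+1)
    (inl [:: I; D; unaries (head 0 Q :: M); unaries (behead Q); [::]; [::]; [::]]).
Proof.
have loop n R T : ~~ starts (pred1 one) R ->
    exec (whilem (top (pred1 one) sQ) (pop sQ ;; push sM one))
      [:: I; D; T; unary n ++ R; [::]; [::]; [::]] (5 * n).+1
      (inl [:: I; D; unary n ++ T; R; [::]; [::]; [::]]).
  move=> R1; elim: n T => [|n IH] T.
    by apply: exec_weaken (exec_whilem_done _ _); rewrite // topE.
  rewrite -(unary_cat_one n T); apply: exec_weaken; last first.
    eapply exec_whilem; [by rewrite topE | | exact: IH].
    by exec_next; exact: exec_push.
  by lia.
(* For an empty queue only a separator is pushed, the block of the default head 0, and the last pop
   has no effect. *)
rewrite unaries_cons; case: Q => [|n Q].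
  apply: exec_weaken; last first.
    exec_next; eapply exec_seqm; first exact: (loop 0 [::]).
    exact: exec_pop.
  by lia.
rewrite unaries_cons; apply: exec_weaken; last first.
  exec_next; eapply exec_seqm; first exact: (loop n (sep :: unaries Q)).
  exact: exec_pop.
by rewrite size_cat size_nseq; lia.
Qed.

(** A successful north step keeps the total length of the two lists, as the new separator makes up
    for the unit of capacity spent. An east step adds at most one separator. Hence [N], which also
    counts the remaining path, bounds the lists throughout. *)
Lemma exec_color_path d D M Q N :
  size (unaries M) + size (unaries Q) + size d <= N ->
  exists s, exec color_path
    [:: map letter_step d; D; unaries M; unaries Q; [::]; [::]; [::]]
    (110 * size d * N.+1).+1
    (if greedy d M Q then inl s else inr false).
Proof.
elim: d M Q => [|[] d IH] M Q leN.
- by eexists; apply: exec_weaken (exec_whilem_done _ _); rewrite ?nonemptyE.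
- have assignP := exec_assign (map letter_step d) D M Q.
  have := sumn_extract_max 0 M; have := size_extract_max 0 M.
  rewrite [greedy _ _ _]/=; case: extract_max assignP => M' [|x] assignP /= szM sumM.
    exists [::]; apply: exec_weaken; last first.
      eapply exec_whilem_stop; first by rewrite nonemptyE.
      eapply exec_ifm_true; first by rewrite topE.
      by exec_next; exact: assignP.
    by nia.
  have [|s Hs] := IH M' (rcons Q x).
    move: leN; rewrite !size_unaries size_rcons -cats1 sumn_cat /=; lia.
  exists s; apply: exec_weaken; last first.
    eapply exec_whilem; [by rewrite nonemptyE | | exact: Hs].
    eapply exec_ifm_true; first by rewrite topE.
    by exec_next; exact: assignP.
  rewrite /= in leN *; nia.
have releaseP := exec_release (map letter_step d) D M Q.
have [|s Hs] := IH (head 0 Q :: M) (behead Q).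
  by move: leN; rewrite !size_unaries; case: Q {releaseP} => [|n Q] /=; lia.
exists s; apply: exec_weaken; last first.
  eapply exec_whilem; [by rewrite nonemptyE | | exact: Hs].
  eapply exec_ifm_false; first by rewrite topE.
  by exec_next; exact: releaseP.
rewrite /= in leN *; nia.
Qed.

(** * The whole program *)

Lemma ballotP x d : reflect
  (forall k, count_mem east (take k d) <= x + count_mem north (take k d)) (ballot x d).
Proof.
elim: d x => [|[] d IH] x /=; first by apply: ReflectT => k.
  apply: (iffP (IH _)) => H k.
    by case: k => [|k] //=; rewrite add0n add1n addnS -addSn; apply: H.
  by have := H k.+1; rewrite /= add0n add1n addnS -addSn.
apply: (iffP andP) => [[x0 /IH H] [|k] //=|H].
  by rewrite add0n add1n -(prednK x0) addSn ltnS; apply: H.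
have := H 1; rewrite /= take0 !addn0 => x0; split=> //; apply/IH => k.
by have := H k.+1; rewrite /= add0n add1n -{1}(prednK x0) addSn ltnS.
Qed.

(** The last condition is what an empty [sX] after [read_path] means, the height there being a
    truncated difference; the reverse inequality comes from [ballot]. *)
Lemma dyckP n d : is_dyck n d <->
  [/\ ballot 0 d, count_mem north d = n & count_mem north d <= count_mem east d].
Proof.
split=> [[dn de /(ballotP 0) db]|[/ballotP db dn de]]; first by split; rewrite ?dn ?de.
split=> //; apply/eqP; rewrite -dn eqn_leq de andbT.
by have := db (size d); rewrite take_size.
Qed.

(** The weights are reversed because reading them stacks them. *)
Definition accepted (d : seq step) (w : seq nat) : Prop :=
  [/\ is_dyck (size w) d, sumn w = size w & greedy d (rev w) [::]].

(** The bound depends on the path alone although [rest] is arbitrary: malformed or excessive weights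
    are rejected within this time. *)
Lemma exec_decide d rest : ~~ starts is_step rest ->
  exists b : bool,
    exec decide ((map letter_step d ++ rest) :: nseq 6 [::])
      (1000 * (size d).+1 ^ 3) (inr b) /\
    (b <-> exists w, rest = encode_weights w /\ accepted d w).
Proof.
move=> nstep; set n := count_mem north d; set P := (size d).+1.
have nP : n.+1 <= P by apply: count_size.
(* The summands account for reading the path, reading the weights and coloring, with room for the
   tests and pours in between. *)
have bound t : t <= 11 * P + 100 * n.+1 * (n.+1 * n.+1) + 500 * (P * P) ->
    t <= 1000 * P ^ 3.
  move/leq_trans; apply; have n3 : n.+1 * (n.+1 * n.+1) <= P * (P * P).
    by rewrite !leq_mul.
  have P2 : P * P <= P * (P * P) by apply: leq_pmull.
  have P1 : P <= P * P by apply: leq_pmull.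
  by rewrite -[P ^ 3]/(P * (P * P)) -mulnA; lia.
have := exec_read_path d [::] [::] 0 0 0 [::] nstep.
rewrite !addn0 add0n -/n; case: ifP => [db|ndb] path_d; last first.
  exists false; split; last by split=> // -[w [_ [/dyckP[]]]]; rewrite ndb.
  by apply: exec_weaken (exec_seqm_stop _ path_d); apply: bound; rewrite /P; lia.
have [ne|en] := leqP n (count_mem east d); last first.
  exists false; split.
    apply: exec_weaken; last first.
      eapply exec_seqm; first exact: path_d.
      eapply exec_ifm_true; last exact: exec_reject.
      by rewrite nonemptyE /= -size_eq0 size_nseq subn_eq0 -ltnNge.
    by apply: bound; rewrite /P; lia.
  by split=> // -[w [_ [/dyckP[_ _]]]]; rewrite -/n leqNgt en.
have x0 : n - count_mem east d = 0 by apply/eqP; rewrite subn_eq0.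
rewrite x0 in path_d.
have [[w [restE sum_w size_w weights]]|[weights no]] :=
    exec_read_weights rest (catrev (map letter_step d) [::]) [::] n (leqnn n); last first.
  exists false; split.
    apply: exec_weaken; last first.
      eapply exec_seqm; first exact: path_d.
      eapply exec_ifm_false; first by rewrite nonemptyE.
      exact: exec_seqm_stop weights.
    by apply: bound; rewrite /P; nia.
  split=> // -[w [restE [/dyckP[_ sz _] sum_w _]]]; case: (no w restE).
  - by rewrite sum_w -sz.
  by rewrite -sz.
suff [b [bP bE]] : exists b : bool,
    exec decide ((map letter_step d ++ rest) :: nseq 6 [::]) (1000 * P ^ 3) (inr b) /\
    (b <-> accepted d w).
  exists b; split=> //; apply: (iff_trans bE).
  split=> [aw|[v [vE]]]; first by exists w.
  by move: vE; rewrite restE => /encode_weights_inj <-.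
have [/andP[/eqP sum0 /eqP size0]|bad] :=
    boolP ((n - sumn w == 0) && (n - size w == 0)); last first.
  exists false; split.
    apply: exec_weaken; last first.
      eapply exec_seqm; first exact: path_d.
      eapply exec_ifm_false; first by rewrite nonemptyE.
      eapply exec_seqm; first exact: weights.
      eapply exec_ifm_true; last exact: exec_reject.
      by rewrite !nonemptyE /= -!size_eq0 !size_nseq -negb_and.
    by apply: bound; rewrite /P; nia.
  split=> // -[/dyckP[_ sz _] sum_eq _]; case/negP: bad.
  by rewrite sum_eq -sz -/n subnn.
have {}sum_w : sumn w = n by lia.
have {}size_w : size w = n by lia.
rewrite sum0 size0 in weights.
(* The list of capacities consists of n ones and n separators, and n <= size d. *)
have [|s color] := @exec_color_path d [::] (rev w) [::] (3 * size d).
  rewrite !size_unaries sumn_rev size_rev sum_w size_w /=; rewrite -ltnS -/P in nP *; lia.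
have pourD := @exec_pour sD sI [:: [::]; catrev (map letter_step d) [::];
  unaries (catrev w [::]); [::]; [::]; [::]; [::]] isT erefl.
rewrite /= !catrevE !cats0 revK size_rev size_map in pourD.
rewrite !catrevE !cats0 in weights path_d.
have final : exec (color_path ;; stop _ _ true)
    [:: map letter_step d; [::]; unaries (rev w); [::]; [::]; [::]; [::]]
    ((110 * size d * (3 * size d).+1).+1 + 1) (inr (greedy d (rev w) [::])).
  move: color; case: greedy => color; first exact: exec_seqm color (exec_stop _ _ _).
  exact: exec_weaken (leq_addr _ _) (exec_seqm_stop _ color).
exists (greedy d (rev w) [::]); split.
  apply: exec_weaken; last first.
    eapply exec_seqm; first exact: path_d.
    eapply exec_ifm_false; first by rewrite nonemptyE.
    eapply exec_seqm; first exact: weights.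
    eapply exec_ifm_false; first by rewrite !nonemptyE.
    eapply exec_seqm; first exact: pourD.
    exact: final.
  by apply: bound; rewrite /P; nia.
rewrite /accepted sum_w size_w; split=> [gr|[]//]; split=> //.
by apply/dyckP.
Qed.

End Program.

(** * From the program to the decision problem *)

Lemma nonvanishingP (x : instance) :
  nonvanishing x <-> accepted (inst_path x) (inst_weight x).
Proof.
case: x => n d dP w; rewrite /nonvanishing /accepted /= size_tuple.
apply: (iff_trans (greedy_correct dP (M := rev w) _)); first by rewrite perm_rev.
by split=> [[]|[]].
Qed.

Lemma nonvanishing_languageP d rest : ~~ starts is_step rest ->
  nonvanishing_language (map letter_step d ++ rest) <->
  exists w, rest = encode_weights w /\ accepted d w.
Proof.
move=> nstep; split=> [[x [E /nonvanishingP acc]]|[w [-> acc]]].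
  have [/(inj_map letter_step_inj) -> ->] := span_inj (all_step _) (all_step _)
    nstep (encode_weights_step _) E.
  by exists (inst_weight x).
have [dP _ _] := acc; exists (Instance dP (in_tuple w)).
by split; [|apply/nonvanishingP].
Qed.

(** Brings a cubic bound to the form c * m ^ k + c: m + 1 <= 2m for positive m, and the constant
    covers m = 0. *)
Lemma cube_bound m : m.+1 ^ 3 <= 8 * m ^ 3 + 8.
Proof.
case: m => // m; apply: leq_trans (leq_addr _ _).
by rewrite -[8]/(2 ^ 3) -expnMn leq_exp2r //; lia.
Qed.

Theorem proposition7p9 :
  in_P nonvanishing_language /\
  solvable_in_poly_time encode inst_n nonvanishing.
Proof.
split.
  (* The factor 2 comes from the simulation of pushes, 8 from [cube_bound] and 1000 from
     [exec_decide]. *)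
  exists (tm_of_stack decide), (2 * (8 * 1000)), 3 => w.
  have [d [rest [-> nstep]]] : exists d r,
      w = map letter_step d ++ r /\ ~~ starts is_step r.
    by apply: span_exists => -[[s|]|] // _; exists s.
  have [b [run bP]] := exec_decide d nstep.
  exists b; split.
    set m := size _; rewrite -[2 * _ * _]mulnA -mulnDr.
    apply: exec_tm_of_stack; apply: exec_weaken run.
    have dm : (size d).+1 ^ 3 <= m.+1 ^ 3.
      by rewrite leq_exp2r // ltnS /m size_cat size_map leq_addr.
    by have := cube_bound m; lia.
  exact: iff_trans bP (iff_sym (nonvanishing_languageP d nstep)).
(* The path has 2n steps, which multiplies the previous factor 8 by 2 ^ 3. *)
exists (tm_of_stack decide), (2 * (64 * 1000)), 3 => x.
have nstep := encode_weights_step (inst_weight x).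
have [b [run bP]] := exec_decide (inst_path x) nstep.
exists b; split.
  set m := inst_n x; rewrite -[2 * _ * _]mulnA -mulnDr.
  apply: exec_tm_of_stack; apply: exec_weaken run.
  have sz : size (inst_path x) = m + m.
    have [north_n east_n _] := inst_dyck x.
    rewrite -(count_predC (pred1 north)) north_n; congr (_ + _).
    by rewrite -[RHS]east_n; apply: eq_count => -[].
  have dm : (size (inst_path x)).+1 ^ 3 <= (2 * m.+1) ^ 3.
    by rewrite leq_exp2r // sz; lia.
  rewrite expnMn in dm; have := cube_bound m; lia.
apply: (iff_trans bP); split=> [[w [/encode_weights_inj wE acc]]|acc].
  by apply/nonvanishingP; rewrite wE.
by exists (inst_weight x); split=> //; apply/nonvanishingP.
Qed.
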